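(* For $n\ge 1$ let $p_3(n)$ be the weighted count of those partitions of $n$ that contain at least one even part and satisfy: (i) if $\lambda$ is the largest even part, then every positive even integer less than $\lambda$ appears exactly once as a part, while $\lambda$ itself appears at least once and may appear more than once; (ii) all odd parts are less than $\lambda$, and each odd number appears as a part an even number of times or not at all. Each such partition is counted with weight (iii) $(-1)^{e}$, where $e$ is the number of appearances of even parts (counted with multiplicity). Then, as $z\to1^-$, $$\sum_{n\ge1}p_3(n)z^n=O\left(\frac{1}{1-z}\right)$$ and $$\sum_{\substack{n\ge 1\\ p_3(n)>0}} z^n=O\left(\frac{1}{(1-z)\sqrt{\log\left(\frac{1}{1-z}\right)}}\right).$$
   Context: A partition of $n$ is a finite multiset of positive integers (the parts) with sum $n$. The variable $z$ is real, $0<z<1$. The notation $f(z)=O(g(z))$ as $z\to1^-$ means that there is a constant $K>0$ such that $|f(z)|\le K g(z)$ for all $z<1$ sufficiently close to $1$. The sum over $p_3(n)>0$ runs over those $n\ge1$ for which the integer $p_3(n)$ is strictly positive. *)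

(* Defs.v *)
From HB Require Import structures.
From mathcomp Require Import all_boot all_order all_algebra.
From mathcomp Require Import all_classical all_reals all_analysis.

Set Implicit Arguments.
Unset Strict Implicit.
Unset Printing Implicit Defensive.

Import Order.TTheory GRing.Theory Num.Theory.
Import numFieldNormedType.Exports.

Local Open Scope ring_scope.
Local Open Scope classical_set_scope.

Section Partitions.
Variable n : nat.

(* A finite multiset is given by its multiplicity function: [m k] is the number
   of appearances of [k]. Parts and multiplicities of a partition of [n] are at
   most [n], so that bounding both by [n] loses no partition. *)
Definition mult := {ffun 'I_n.+1 -> 'I_n.+1}.

Implicit Types (m : mult) (k l : 'I_n.+1).

Definition is_part m k : bool := (0 < m k)%N.

Definition is_partition m : bool :=
  ~~ is_part m ord0 && ((\sum_(k : 'I_n.+1) k * m k)%N == n).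

Definition is_largest_even_part m l : bool :=
  [&& ~~ odd l, is_part m l
    & [forall k : 'I_n.+1, (~~ odd k && is_part m k) ==> (k <= l)%N]].

Definition even_parts_cond m : bool :=
  [forall l, is_largest_even_part m l ==>
    [forall k : 'I_n.+1, [&& ~~ odd k, 0 < k & k < l]%N ==> (m k == 1%N :> nat)]].

Definition odd_parts_cond m : bool :=
  [forall l, is_largest_even_part m l ==>
    [forall k : 'I_n.+1, (odd k && is_part m k) ==> (k < l)%N]]
  && [forall k : 'I_n.+1, odd k ==> ~~ odd (m k)].

Definition p3_admissible m : bool :=
  [&& is_partition m,
      [exists k : 'I_n.+1, ~~ odd k && is_part m k],
      even_parts_cond m
    & odd_parts_cond m].

Definition num_even_parts m : nat := (\sum_(k : 'I_n.+1 | ~~ odd k) m k)%N.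

Definition p3 : int :=
  \sum_(m : mult | p3_admissible m) (-1) ^+ num_even_parts m.

End Partitions.

Section Asymptotics.
Variable R : realType.
Implicit Types (f g : R -> R) (z : R).

Definition bigO_at_left1 f g : Prop :=
  exists2 K : R, 0 < K & \forall z \near (1 : R)^'-, `|f z| <= K * g z.

Definition p3_partial_sum z (N : nat) : R :=
  \sum_(1 <= n < N) (p3 n)%:~R * z ^+ n.

Definition p3_pos_partial_sum z (N : nat) : R :=
  \sum_(1 <= n < N | 0 < p3 n) z ^+ n.

End Asymptotics.

(* Main.v *)
From HB Require Import structures.
Require Import Defs.
From mathcomp Require Import all_boot all_order all_algebra.
From mathcomp Require Import cyclic qpoly.
From mathcomp Require Import all_classical all_reals all_analysis.
From mathcomp Require Import ring lra zify.
Import Order.TTheory GRing.Theory Num.Theory.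
Import numFieldNormedType.Exports.

(** Put q = z^2. Sorting the partitions by their largest even part 2m, and using
    that the odd parts come in pairs,

      sum_n p3(n) z^n
        = sum_(m >= 1) (-1)^m q^(m(m+1)/2) / ((1 + q^m) (1-q)(1-q^3)...(1-q^(2m-1))).

    Single summands become exponentially large in 1/(1-z), so that the size of the
    sum cannot be read off this form. It can after the transformation
    [theta_identity]: if F denotes the sum above, then

      1 + 2 F = sum_(y >= 0) w_y (-1)^y q^(y^2)
                  sum_(r >= 2y) (-1)^r (q^(r^2) - q^((r+1)^2)),   w_0 = 1, w_y = 2,

    a theta series of the form x^2 + y^2 restricted to a cone. The identity is an
    instance of Bailey's transform: the factor 1/((q)_m (q;q^2)_m) is expanded
    along the products 1/((q)_(m-2y) (q)_(m+2y)) ([bailey_pair]), the summations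
    are exchanged, and the sum over m of each product is evaluated
    ([bailey_gammaE]). Both steps are telescoping sums of rational functions. They
    are carried out in a ring where q is nilpotent, so that every series is finite
    and every 1 - q^j with j > 0 is a unit; the quotients of the polynomial ring by
    powers of X then deliver the coefficients.

    Comparing coefficients, |p3(n)| is at most the number of representations of n
    as 2(x^2 + y^2), each counted at most twice ([theta_bound]). There are O(M)
    lattice points with 2(x^2 + y^2) <= M, whence the first estimate by partial
    summation ([power_sum_le]).

    Moreover p3(n) <> 0 forces n = 2(x^2 + y^2) = (x+y)^2 + (x-y)^2, so the second
    estimate follows from the upper bound O(M / sqrt(log M)) in Landau's theorem
    on sums of two squares ([two_sqr_count_bound]). A sum of two squares is d^2 e
    or 2 d^2 e with e squarefree and composed of primes congruent to 1 modulo 4.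
    Weighting the pairs (d, e) with d^2 e <= M by log M, splitting
    log M = log (M/(d^2 e)) + 2 log d + log e, and removing one prime from e with
    Chebyshev's bound shows that the number of pairs is
    O((M / log M) sum_(e <= M) 1/e) ([sqfree_pairs_le]). Finally the square of
    sum 1/e is at most sum_(n <= M^2) r(n)/n where r is the divisor sum of the
    character chi modulo 4; since r(n) >= 0 and the values of chi alternate in sign,
    that sum is at most the harmonic sum up to M^2, hence O(log M)
    ([split_harmonic_sqr]). *)

Set Implicit Arguments.
Unset Strict Implicit.
Unset Printing Implicit Defensive.

Local Open Scope ring_scope.
Local Open Scope classical_set_scope.

(** * Truncated q-series and the theta identity *)

Section QSeries.
Variables (A : comNzRingType) (q : A) (N : nat).
Hypothesis qN : q ^+ N = 0.

(** With x^N = 0 this is the inverse of 1 - x. *)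
Definition geom (x : A) : A := \sum_(c < N) x ^+ c.
(** The q-Pochhammer symbol (q;q)_j, written (q)_j below. *)
Definition qpoch (j : nat) : A := \prod_(l < j) (1 - q ^+ l.+1).
Definition qpochV (j : nat) : A := \prod_(l < j) geom (q ^+ l.+1).
(** 1/(q)_(n-k) with the usual convention 1/(q)_(-j) = 0 for j > 0, which makes the
    recurrences [qpochBVS] and [qpochBVSS] hold for all n and k. *)
Definition qpochBV (n k : nat) : A := if (k <= n)%N then qpochV (n - k) else 0.
(** 1/(q;q^2)_n. *)
Definition qpoch_oddV (n : nat) : A := \prod_(l < n) geom (q ^+ l.*2.+1).

Lemma expq0 n : (N <= n)%N -> q ^+ n = 0.
Proof. by move=> /subnK <-; rewrite exprD qN mulr0. Qed.

Lemma geomK x : x ^+ N = 0 -> (1 - x) * geom x = 1.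
Proof.
move=> xN; have := subrX1 x N; rewrite xN => /esym/(congr1 -%R).
by rewrite -mulNr !opprB subr0.
Qed.

Lemma geom_qK j : (0 < j)%N -> (1 - q ^+ j) * geom (q ^+ j) = 1.
Proof. by move=> j0; apply: geomK; rewrite -exprM expq0 // leq_pmull. Qed.

Lemma geom_NqK j : (0 < j)%N -> (1 + q ^+ j) * geom (- q ^+ j) = 1.
Proof.
move=> j0; rewrite -{1}[q ^+ j]opprK; apply: geomK.
by rewrite exprNn -exprM expq0 ?mulr0 // leq_pmull.
Qed.

Lemma qpochS j : qpoch j.+1 = qpoch j * (1 - q ^+ j.+1).
Proof. exact: big_ord_recr. Qed.

Lemma qpochVS j : qpochV j = qpochV j.+1 * (1 - q ^+ j.+1).
Proof.
by rewrite [in RHS]/qpochV big_ord_recr /= -mulrA [geom _ * _]mulrC geom_qK ?mulr1.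
Qed.

Lemma qpochK j : qpoch j * qpochV j = 1.
Proof.
rewrite /qpoch /qpochV -big_split /= big1 // => i _; exact: geom_qK.
Qed.

Lemma qpochBVS n k : qpochBV n k.+1 = qpochBV n k * (1 - q ^+ (n - k)).
Proof.
rewrite /qpochBV; case: ltngtP => [kn|//|->]; rewrite ?mul0r //.
  by rewrite -(subnSK kn) -qpochVS.
by rewrite subnn subrr mulr0.
Qed.

Lemma qpochBVSS n k : qpochBV n.+1 k.+1 = qpochBV n k.
Proof. by rewrite /qpochBV ltnS subSS. Qed.

(** 2/(1 + q^n). The numerator 2 gives a meaning to n = 0, where 1 + q^0 = 2 need
    not be a unit. *)
Definition two_inv1Dq (n : nat) : A :=
  if n is 0 then 1 else 2 * geom (- q ^+ n).

Lemma two_inv1DqP n : two_inv1Dq n * (1 + q ^+ n) = 2.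
Proof.
case: n => [|n]; rewrite /two_inv1Dq ?expr0 ?mul1r //.
by rewrite mulrAC -mulrA geom_NqK ?mulr1.
Qed.

Lemma leq_bin2S n : (n <= 'C(n.+1, 2))%N.
Proof. by rewrite binS bin1 leq_addl. Qed.

Lemma qtriS n : q ^+ 'C(n.+1, 2) = q ^+ 'C(n, 2) * q ^+ n.
Proof. by rewrite binS bin1 exprD. Qed.

(** The sequence delta_n of the Bailey transform. *)
Definition bailey_delta (n : nat) : A := (-1) ^+ n * q ^+ 'C(n.+1, 2) * qpoch n.

Lemma bailey_deltaS n :
  bailey_delta n.+1 = - bailey_delta n * q ^+ n.+1 * (1 - q ^+ n.+1).
Proof. rewrite /bailey_delta qpochS (qtriS n.+1) !exprS; ring. Qed.

Lemma bailey_delta_eq0 : bailey_delta N = 0.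
Proof. by rewrite /bailey_delta expq0 ?leq_bin2S // mulr0 mul0r. Qed.

Lemma delta_sum0 L :
  \sum_(n < L) bailey_delta n * qpochBV n 0 * qpochV n.+1
    = 1 - (-1) ^+ L * q ^+ 'C(L.+1, 2) * qpochV L.
Proof.
elim: L => [|L IH]; first by rewrite big_ord0 /qpochV big_ord0 !mulr1 subrr.
rewrite big_ord_recr /= IH /qpochBV leq0n subn0 /bailey_delta.
rewrite -[_ * qpoch L * qpochV L]mulrA qpochK mulr1 (qtriS L.+1).
rewrite [qpochV L]qpochVS !exprS; ring.
Qed.

(** With t_k(n) the n-th term of the second sum, t_(k+1)(n) + q^(k+1) t_k(n) is the
    difference h(n+1) - h(n) for h(n) the right-hand side at L = n, and h(0) = 0. *)
Lemma delta_sum_telescope L k :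
  \sum_(n < L) bailey_delta n * qpochBV n k.+1 * qpochV (n + k).+2
  + q ^+ k.+1 * \sum_(n < L) bailey_delta n * qpochBV n k * qpochV (n + k).+1
  = - (1 + q ^+ k.+1) * bailey_delta L * qpochBV L k.+1 * qpochV (L + k).+1.
Proof.
elim: L => [|L IH].
  by rewrite !big_ord0 /qpochBV ltn0 !mulr0 mul0r addr0.
rewrite !big_ord_recr /= mulrDr addrACA IH qpochBVSS bailey_deltaS qpochBVS.
case: (leqP k L) => kL; last first.
  by rewrite /qpochBV leqNgt kL /= !(mul0r, mulr0, addr0).
rewrite addSn [qpochV (L + k).+1]qpochVS -(subnK kL) addnK.
move: (L - k)%N => j; set a := qpochBV _ _; set b := qpochV _; set c := bailey_delta _.
rewrite !(exprS, exprD); ring.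
Qed.

(** By [delta_sum_telescope] with L = N, where the boundary term vanishes, the sum is
    multiplied by -q^(k+1) when k grows by 1; this is a limiting case of the
    q-analogue of Gauss's summation theorem. *)
Lemma delta_sum k :
  \sum_(n < N) bailey_delta n * qpochBV n k * qpochV (n + k).+1
    = (-1) ^+ k * q ^+ 'C(k.+1, 2).
Proof.
elim: k => [|k IH].
  under eq_bigr do rewrite addn0.
  by rewrite delta_sum0 expq0 ?leq_bin2S // mulr0 mul0r subr0 expr0 mul1r.
have := delta_sum_telescope N k; rewrite bailey_delta_eq0 IH mulr0 !mul0r.
under eq_bigr do rewrite -addnS.
move/eqP; rewrite addr_eq0 => /eqP ->; rewrite (qtriS k.+1) !exprS; ring.
Qed.

Lemma sqr_tri k : (k ^ 2 = 'C(k, 2) + 'C(k.+1, 2))%N.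
Proof.
elim: k => // k IH; have kS := binS k 1; rewrite bin1 in kS.
by rewrite (binS k.+1 1) bin1 (_ : k.+1 ^ 2 = k ^ 2 + k.*2.+1)%N; lia.
Qed.

(** The sequence gamma_k conjugate to 2 delta_n / (1 + q^n), normalised by the power of
    q and the factor 1 + q^k with which it enters [theta_identity]. *)
Definition bailey_gamma (k : nat) : A :=
  q ^+ 'C(k, 2) * (1 + q ^+ k) *
  \sum_(n < N) bailey_delta n * two_inv1Dq n * qpochBV n k * qpochV (n + k).

(** Before summation over n the difference is 1 + q^n times a term of [delta_sum]; the
    factor 1 + q^n cancels the denominator. *)
Lemma bailey_gammaS k :
  bailey_gamma k - bailey_gamma k.+1 = 2 * (-1) ^+ k * (q ^+ (k ^ 2) - q ^+ (k.+1 ^ 2)).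
Proof.
rewrite /bailey_gamma !big_distrr /= -sumrB.
transitivity (2 * q ^+ 'C(k, 2) * (1 - q ^+ (2 * k).+1) *
   \sum_(n < N) bailey_delta n * qpochBV n k * qpochV (n + k).+1).
  rewrite big_distrr; apply: eq_bigr => i _ /=.
  rewrite -(two_inv1DqP i) qpochBVS qtriS addnS [qpochV (i + k)]qpochVS.
  case: (leqP k i) => ki; last first.
    by rewrite /qpochBV leqNgt ki /= !(mul0r, mulr0, subr0).
  rewrite -(subnK ki) addnK; move: (i - k)%N => j.
  rewrite mul2n -addnn !(exprS, exprD); ring.
rewrite delta_sum.
have -> : (k.+1 ^ 2 = k ^ 2 + (2 * k).+1)%N by lia.
rewrite sqr_tri [q ^+ (_ + (2 * k).+1)]exprD [q ^+ (_ + 'C(k.+1, 2))]exprD; ring.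
Qed.

Lemma bailey_gammaE k :
  bailey_gamma k = \sum_(k <= r < N) 2 * (-1) ^+ r * (q ^+ (r ^ 2) - q ^+ (r.+1 ^ 2)).
Proof.
have gamma0 j : (N <= j)%N -> bailey_gamma j = 0.
  move=> Nj; rewrite /bailey_gamma big1 ?mulr0 // => i _.
  by rewrite /qpochBV leqNgt (leq_trans (ltn_ord i) Nj) mulr0 mul0r.
case: (leqP N k) => Nk; first by rewrite gamma0 // big_geq.
under eq_bigr do rewrite -bailey_gammaS -opprB.
by rewrite sumrN telescope_sumr ?(ltnW Nk) // (gamma0 N) // sub0r opprK.
Qed.

(** The weights that fold a sum over all integers y, even in y, to y >= 0. *)
Definition sym_weight (y : nat) : A := if y is 0 then 1 else 2.

(** (-1)^y q^(3y^2-y), the exponent being written y^2 + (2y)(2y-1)/2: the first part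
    goes to the theta series and the second to the normalisation of [bailey_gamma]. *)
Definition bailey_coef (y : nat) : A := (-1) ^+ y * (q ^+ (y ^ 2) * q ^+ 'C(y.*2, 2)).

Definition bailey_term (n y : nat) : A :=
  bailey_coef y * (1 + q ^+ y.*2) * qpochBV n y.*2 * qpochV (n + y.*2).

Lemma bailey_coefS y : bailey_coef y.+1 = - bailey_coef y * q ^+ y.*2 ^+ 3 * q ^+ 2.
Proof.
rewrite /bailey_coef doubleS !qtriS (_ : y.+1 ^ 2 = y ^ 2 + y.*2.+1)%N; last by lia.
rewrite !(exprS, exprD); ring.
Qed.

(** The recurrence that the right-hand side of [bailey_pair] satisfies holds up to a
    difference G(y+1) - G(y) in each symmetrised term. The weighted sum over y <= Y is
    2 G(Y+1), as the contribution of y = 0 cancels against G(0). *)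
Lemma bailey_telescope n Y :
  \sum_(y < Y.+1) sym_weight y *
     ((1 - q ^+ n.*2.+1) * (1 - q ^+ n.+1) * bailey_term n.+1 y - bailey_term n y)
  = 2 * bailey_coef Y * q ^+ n.+1 * q ^+ Y.*2 ^+ 2 *
    qpochBV n.+1 Y.*2.+2 * qpochV (n + Y.*2).+1.
Proof.
elim: Y => [|Y IH].
  rewrite big_ord_recl big_ord0 addr0 /bailey_term /= !qpochBVSS addn0 mul1r addn0.
  rewrite /bailey_coef qpochBVS subn0 [qpochBV n 0]/qpochBV subn0 leq0n.
  rewrite /qpochBV subn0 leq0n (qpochVS n) -addnn !(exprS, exprD, expr0); ring.
rewrite big_ord_recr IH /= bailey_coefS /bailey_term bailey_coefS doubleS.
rewrite !qpochBVSS !addSn !addnS ![qpochBV n _.+2]qpochBVS.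
rewrite [qpochV (n + Y.*2).+1]qpochVS [qpochV (n + Y.*2).+2]qpochVS.
case: (leqP Y.*2.+1 n) => Yn; last first.
  by rewrite /qpochBV [(Y.*2 < n)%N]ltnNge -ltnS Yn /= !(mul0r, mulr0, subr0, addr0).
rewrite (_ : n - Y.*2.+2 = (n - Y.*2.+1).-1)%N; last by lia.
move: (subnKC Yn); move: (n - Y.*2.+1)%N => m <-.
set a := qpochBV _ _; set b := qpochV _; set c := bailey_coef _.
case: m @a @b => [|m] a b; rewrite /= -!addnn !(exprS, exprD, expr0); ring.
Qed.

(** Both sides are multiplied by (1 - q^(2n+1)) (1 - q^(n+1)) when n+1 is replaced by
    n: obviously for the right-hand side, by [bailey_telescope] for the left-hand side.
    This is Slater's Bailey pair C(1), relative to 1. *)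
Lemma bailey_pair n : (n < N)%N ->
  \sum_(y < N) sym_weight y * bailey_term n y = 2 * qpochV n * qpoch_oddV n.
Proof.
elim: n => [|n IH] nN.
  rewrite (bigD1 (Ordinal nN)) //= big1 ?addr0 => [|[[|y] yN]]; rewrite ?eqxx //; last first.
    by rewrite /bailey_term /qpochBV /= mulr0 mul0r mulr0.
  rewrite /bailey_term /bailey_coef /qpochBV /= addn0.
  by rewrite /qpochV /qpoch_oddV !big_ord0 !(expr0, mulr1, mul1r).
have {}IH := IH (ltnW nN).
have : (1 - q ^+ n.*2.+1) * (1 - q ^+ n.+1) * \sum_(y < N) sym_weight y * bailey_term n.+1 y
   = 2 * qpochV n * qpoch_oddV n.
  rewrite -IH; apply/eqP; rewrite -subr_eq0 big_distrr -sumrB.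
  have := bailey_telescope n N.-1; rewrite (ltn_predK nN) => H.
  apply/eqP; transitivity (\sum_(y < N) sym_weight y * ((1 - q ^+ n.*2.+1) *
      (1 - q ^+ n.+1) * bailey_term n.+1 y - bailey_term n y)).
    by apply: eq_bigr => y _ /=; ring.
  rewrite H {1}/qpochBV ifN ?mulr0 ?mul0r //; lia.
move=> H; have := congr1 (fun x => geom (q ^+ n.*2.+1) * geom (q ^+ n.+1) * x) H.
rewrite [qpoch_oddV _.+1]/qpoch_oddV big_ord_recr /= -/(qpoch_oddV n) (qpochVS n).
have h1 := @geom_qK n.*2.+1 isT; have h2 := @geom_qK n.+1 isT.
move: (\sum_(y < N) _) => S H'.
transitivity (((1 - q ^+ n.*2.+1) * geom (q ^+ n.*2.+1)) *
   ((1 - q ^+ n.+1) * geom (q ^+ n.+1)) * S).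
  by rewrite h1 h2 !mul1r.
transitivity (geom (q ^+ n.*2.+1) * geom (q ^+ n.+1) *
      ((1 - q ^+ n.*2.+1) * (1 - q ^+ n.+1) * S)); first by ring.
rewrite H'.
transitivity (((1 - q ^+ n.+1) * geom (q ^+ n.+1)) *
   (2 * qpochV n.+1 * (qpoch_oddV n * geom (q ^+ n.*2.+1)))); first by ring.
by rewrite h2 mul1r.
Qed.

(** Insert [bailey_pair] in the left-hand side, exchange the summations and evaluate
    the inner sum by [bailey_gammaE]. *)
Lemma theta_identity :
  \sum_(n < N) 2 * ((-1) ^+ n * q ^+ 'C(n.+1, 2) * two_inv1Dq n * qpoch_oddV n)
  = \sum_(y < N) sym_weight y * (-1) ^+ y * q ^+ (y ^ 2) *
      \sum_(y.*2 <= r < N) 2 * (-1) ^+ r * (q ^+ (r ^ 2) - q ^+ (r.+1 ^ 2)).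
Proof.
transitivity (\sum_(n < N) bailey_delta n * two_inv1Dq n *
    \sum_(y < N) sym_weight y * bailey_term n y).
  apply: eq_bigr => n _; rewrite bailey_pair // /bailey_delta.
  rewrite -[LHS]mul1r -(qpochK n); ring.
under eq_bigr do rewrite big_distrr.
rewrite exchange_big; apply: eq_bigr => y _ /=.
rewrite -bailey_gammaE /bailey_gamma !big_distrr; apply: eq_bigr => n _ /=.
rewrite /bailey_term /bailey_coef; ring.
Qed.

End QSeries.

(** * The generating function of p3 *)

Lemma sum_even (V : nmodType) (M : nat) (G : nat -> V) :
  (forall k, (M <= k)%N -> G k = 0) ->
  \sum_(c < M | ~~ odd c) G c = \sum_(c < M) G c.*2.
Proof.
move=> G0; transitivity (\sum_(c < M.*2 | ~~ odd c) G c).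
  rewrite (big_ord_widen_cond M.*2 (fun c => ~~ odd c)); last by lia.
  rewrite [RHS](bigID (fun c : 'I__ => (c < M)%N)) /= [X in _ + X]big1 ?addr0 //.
  by move=> c /andP[_]; rewrite -leqNgt; exact: G0.
elim: M {G0} => [|M IH]; first by rewrite !big_ord0.
rewrite big_ord_recr /= -IH doubleS big_mkcond 2!big_ord_recr /= odd_double /= addr0.
by rewrite -big_mkcond.
Qed.

Lemma prod_double (V : comPzRingType) (M : nat) (G : nat -> V) :
  \prod_(k < M.*2) G k = \prod_(i < M) G i.*2 * \prod_(i < M) G i.*2.+1.
Proof.
elim: M => [|M IH]; first by rewrite !big_ord0 mulr1.
by rewrite doubleS !big_ord_recr /= IH; ring.
Qed.

Section GenFun.
Variable n : nat.
Implicit Types (m : mult n) (k l : 'I_n.+1).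

(** Whether [k] may appear [c] times in an admissible partition with largest even part
    [l]. The conditions on different parts are independent, which is what turns the
    generating function into a product. *)
Definition allowed_mult (l k c : nat) : bool :=
  if k == 0%N then c == 0%N else
  if odd k then ~~ odd c && ((k < l)%N || (c == 0%N)) else
  if (k < l)%N then c == 1%N else if k == l then (0 < c)%N else c == 0%N.

Definition part_sign (k : nat) : int := if odd k then 1 else -1.

Lemma admissible_largest m l :
  (p3_admissible m && is_largest_even_part m l) =
  [&& ~~ odd l, (0 < l)%N, (\sum_(k : 'I_n.+1) k * m k)%N == n
    & [forall k : 'I_n.+1, allowed_mult l k (m k)]].
Proof.
apply/idP/idP.
- case/andP => /and4P[/andP[part0 sumn] _ ev /andP[odd1 odd2]] lg.
  move/forallP/(_ l)/implyP/(_ lg)/forallP: ev => ev.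
  move/forallP/(_ l)/implyP/(_ lg)/forallP: odd1 => odd1.
  move/forallP: odd2 => odd2; case/and3P: lg => ol pl /forallP lg.
  rewrite ol sumn /=; apply/andP; split.
    rewrite lt0n; apply: contra part0 => /eqP l0.
    by have -> : ord0 = l by apply/val_inj.
  apply/forallP => k; rewrite /allowed_mult; case: eqP => [k0|/eqP k0].
    by move: part0; rewrite /is_part -leqNgt leqn0; have -> : ord0 = k by apply/val_inj.
  case: ifP => ok.
    rewrite (implyP (odd2 k)) //=; have := odd1 k; rewrite ok /is_part lt0n /=.
    by case: eqP; rewrite ?orbT //= orbF.
  case: ltngtP => kl.
  + by apply: (implyP (ev k)); rewrite ok lt0n k0 kl.
  + by have := lg k; rewrite ok /is_part lt0n leqNgt kl /= implybF negbK.
  + by have -> : k = l by apply/val_inj.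
- case/and4P=> ol l0 sumn /forallP ok.
  have pl : is_part m l.
    by have := ok l; rewrite /allowed_mult (gtn_eqF l0) (negbTE ol) ltnn eqxx.
  have lg k : ~~ odd k && is_part m k ==> (k <= l)%N.
    apply/implyP => /andP[ok' pk]; have := ok k; rewrite /allowed_mult (negbTE ok').
    rewrite /is_part lt0n in pk.
    by case: ifP => _; rewrite ?(negbTE pk) //; case: ltngtP; rewrite ?(negbTE pk).
  have lgP : is_largest_even_part m l.
    by rewrite /is_largest_even_part ol pl; apply/forallP.
  have lgU l' : is_largest_even_part m l' -> l' = l.
    case/and3P=> ol' pl' /forallP lg'; apply/val_inj/eqP; rewrite eqn_leq.
    by rewrite (implyP (lg l')) ?ol' // (implyP (lg' l)) // ol.
  rewrite lgP andbT /p3_admissible /is_partition sumn andbT; apply/and4P; split.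
  + by have := ok ord0; rewrite /allowed_mult /= /is_part lt0n negbK.
  + by apply/existsP; exists l; rewrite ol.
  + apply/forallP => l'; apply/implyP => /lgU ->; apply/forallP => k.
    apply/implyP => /and3P[ek k0 kl]; have := ok k.
    by rewrite /allowed_mult (gtn_eqF k0) (negbTE ek) kl.
  + apply/andP; split.
      apply/forallP => l'; apply/implyP => /lgU ->; apply/forallP => k.
      apply/implyP => /andP[ok' pk]; have := ok k; rewrite /allowed_mult ok'.
      rewrite /is_part lt0n in pk.
      by case: ifP => _; rewrite ?(negbTE pk) // orbF => /andP[].
    apply/forallP => k; apply/implyP => ok'; have := ok k; rewrite /allowed_mult ok'.
    by case: ifP => [_ /eqP -> //|_ /andP[]].
Qed.

Lemma largest_uniq m : p3_admissible m ->
  exists l, forall l', is_largest_even_part m l' = (l' == l).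
Proof.
case/and4P=> _ /existsP[k0 hk0] _ _.
case: (@arg_maxnP _ k0 (fun k => ~~ odd k && is_part m k) (@nat_of_ord _) hk0).
move=> l /andP[ol pl] lmax.
have lgP : is_largest_even_part m l.
  by rewrite /is_largest_even_part ol pl; apply/forallP => k; apply/implyP/lmax.
exists l => l'; apply/idP/eqP => [|->//].
case/and3P=> ol' pl' /forallP lg'; apply/val_inj/eqP; rewrite eqn_leq.
by rewrite (implyP (lg' l)) ?ol // andbT; apply: lmax; rewrite ol'.
Qed.

(** The generating polynomial of the admissible partitions with largest even part [l].
    Multiplicities are cut off at n, which does not affect the coefficient of X^n. *)
Definition largest_poly (l : nat) : {poly int} :=
  \prod_(k < n.+1) \sum_(c < n.+1 | allowed_mult l k c) part_sign k ^+ c *: 'X^(k * c).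

Lemma p3_coef : p3 n = \sum_(l < n.+1 | ~~ odd l && (0 < l)%N) (largest_poly l)`_n.
Proof.
transitivity (\sum_(m : mult n | p3_admissible m) \sum_(l | is_largest_even_part m l)
   (-1) ^+ num_even_parts m : int).
  apply: eq_bigr => m /largest_uniq[l lU].
  by rewrite (eq_bigl _ _ lU) big_pred1_eq.
rewrite (exchange_big_dep (fun l : 'I_n.+1 => ~~ odd l && (0 < l)%N)) /=; last first.
  move=> m l ad lg; have := admissible_largest m l; rewrite ad lg.
  by move/esym/and4P=> [-> ->].
apply: eq_bigr => l /andP[ol l0]; rewrite /largest_poly bigA_distr_big_dep coef_sum /=.
under eq_bigl do rewrite admissible_largest ol l0 /=.
rewrite big_mkcondl big_mkcond [RHS]big_mkcond /=; apply: eq_bigr => m _.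
have -> : (m \in family (fun k c : 'I_n.+1 => allowed_mult l k c)) =
          [forall k : 'I_n.+1, allowed_mult l k (m k)].
  by apply/familyP/forallP.
case: ifP => // _; rewrite scaler_prod coefZ prodrXr coefXn eq_sym.
case: eqP; rewrite ?mulr0 // mulr1 => _.
rewrite /num_even_parts -prodrXr big_mkcond /=.
by apply: eq_bigr => k _; rewrite /part_sign; case: (odd k); rewrite /= ?expr1n.
Qed.

Local Notation trunc_ring := {poly %/ ('X^(n.+1) : {poly int})}.
Local Notation trunc := (in_qpoly ('X^(n.+1) : {poly int})).

Lemma coef_trunc (p : {poly int}) : (trunc p)`_n = p`_n.
Proof.
rewrite /= mk_monic_Xn /= -Pdiv.RingMonic.take_poly_rmodp coef_take_poly ltnSn //.
Qed.

Lemma trunc_small i : (n < i)%N -> trunc 'X^i = 0.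
Proof.
move=> /subnK <-; apply/val_inj => /=.
by rewrite mk_monic_Xn /= -Pdiv.RingMonic.take_poly_rmodp exprD take_polyMXn_0.
Qed.

Let q : trunc_ring := trunc 'X^2.

Lemma truncX2 i : trunc 'X^(i.*2) = q ^+ i.
Proof. by rewrite -muln2 mulnC exprM rmorphXn. Qed.

Lemma q_nilp : q ^+ n.+1 = 0.
Proof. by rewrite -truncX2 trunc_small //; lia. Qed.

(** The factors of [largest_poly] at l = 2j: -q^i for each even part 2i < 2j,
    -q^j/(1 + q^j) for the even part 2j, 1/(1 - q^(2i+1)) for each odd part 2i+1 < 2j,
    and 1 for the other k. *)
Lemma trunc_largest j : (0 < j)%N -> (j.*2 <= n)%N ->
  trunc (largest_poly j.*2) =
   (-1) ^+ j * q ^+ 'C(j.+1, 2) * geom n.+1 (- q ^+ j) * qpoch_oddV q n.+1 j.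
Proof.
move=> j0 jn; rewrite /largest_poly rmorph_prod.
pose F (k : nat) : trunc_ring :=
  trunc (\sum_(c < n.+1 | allowed_mult j.*2 k c) part_sign k ^+ c *: 'X^(k * c)).
have F1 (k : nat) (ok : forall c, allowed_mult j.*2 k c = (c == 0%N)) : F k = 1.
  rewrite /F (big_pred1 ord0) => [|c]; last by rewrite ok.
  by rewrite muln0 !expr0 scale1r rmorph1.
have F_even i : (0 < i < j)%N -> F i.*2 = - q ^+ i.
  move=> /andP[i0 ij]; have n1 : (1 < n.+1)%N by lia.
  rewrite /F (big_pred1 (Ordinal n1)) => [|c].
    by rewrite /part_sign odd_double expr1 scaleN1r rmorphN /= muln1 truncX2.
  by rewrite /allowed_mult double_eq0 (gtn_eqF i0) odd_double ltn_double ij.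
have F_odd i : (i < j)%N -> F i.*2.+1 = geom n.+1 (q ^+ i.*2.+1).
  move=> ij; rewrite /F /geom linear_sum.
  transitivity (\sum_(c < n.+1 | ~~ odd c) trunc 'X^(i.*2.+1 * c)).
    apply: eq_big => [c|c _].
      rewrite /allowed_mult /= odd_double /= (_ : (i.*2.+1 < j.*2)%N) ?andbT //; lia.
    by rewrite /part_sign /= odd_double expr1n scale1r.
  rewrite (sum_even (G := fun c => trunc 'X^(i.*2.+1 * c))) => [|k nk].
    by apply: eq_bigr => c _; rewrite -exprM -truncX2 -doubleMr.
  rewrite trunc_small // (leq_trans nk) // leq_pmull //.
have F_top : F j.*2 = - q ^+ j * geom n.+1 (- q ^+ j).
  rewrite /F /geom linear_sum big_distrr big_mkcond /= big_ord_recl.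
  rewrite {1}/allowed_mult double_eq0 (gtn_eqF j0) odd_double ltnn eqxx add0r.
  rewrite [RHS]big_ord_recr /= -exprS [X in _ + X](_ : _ = 0) ?addr0.
    apply: eq_bigr => c _ /=.
    rewrite /allowed_mult double_eq0 (gtn_eqF j0) odd_double ltnn eqxx /=.
    rewrite /part_sign odd_double -exprS [(- q ^+ j) ^+ _]exprNn -exprM -truncX2.
    rewrite doubleMl /bump add1n.
    by rewrite in_qpolyZ -[(-1 : int) ^+ _]signr_odd scaler_sign -[in RHS]signr_odd mulr_sign.
  rewrite exprNn -exprM -truncX2 trunc_small ?mulr0 // -addnn.
  exact: leq_trans (leq_pmull _ j0) (leq_addr _ _).
rewrite -[LHS]/(\prod_(k < n.+1) F k) -(big_mkord xpredT).
rewrite (big_cat_nat (n := j.*2.+1)) //= big_nat_recr //= big_mkord prod_double F_top.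
have -> : \prod_(j.*2.+1 <= k < n.+1) F k = 1.
  rewrite big_nat big1 // => k /andP[jk _]; rewrite F1 // => c.
  rewrite /allowed_mult (gtn_eqF (leq_trans _ jk)) // ltnNge (ltnW jk) (gtn_eqF jk) /=.
  by case: ifP => _; case: c => [|c]; rewrite /= ?andbF.
rewrite mulr1.
have -> : \prod_(i < j) F i.*2.+1 = qpoch_oddV q n.+1 j.
  by apply: eq_bigr => i _; rewrite F_odd.
have F_prod (k : nat) : (k < j)%N -> \prod_(i < k.+1) F i.*2 = (-1) ^+ k * q ^+ 'C(k.+1, 2).
  elim: k => [|k IH] kj; first by rewrite big_ord_recl big_ord0 F1 // mulr1.
  rewrite big_ord_recr IH 1?ltnW //= F_even ?kj // (qtriS q k.+1) [(-1) ^+ k.+1]exprS; ring.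
have := F_prod j.-1; rewrite prednK // => -> //; rewrite (qtriS q j).
have -> : (-1) ^+ j = - (-1) ^+ j.-1 :> trunc_ring.
  by case: (j) j0 => // i _; rewrite [LHS]exprS mulN1r.
ring.
Qed.

(** The coefficient of X^n in [theta_identity] for q = X^2. The left-hand side has
    constant term 2, which the hypothesis 0 < n removes. *)
Lemma theta_coef : (0 < n)%N ->
  4 * p3 n = \sum_(y < n.+1) \sum_(y.*2 <= r < n.+1)
     (if y == 0%N :> nat then 1 else 2) * (-1) ^+ y * 2 * (-1) ^+ r *
     ((n == (y ^ 2 + r ^ 2).*2)%:R - (n == (y ^ 2 + r.+1 ^ 2).*2)%:R) :> int.
Proof.
move=> n0.
pose L (l : nat) : {poly int} := if (0 < l <= n)%N then largest_poly l else 0.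
have p3L : p3 n = (\sum_(j < n.+1) L j.*2)`_n.
  rewrite p3_coef -(sum_even (G := L)) => [|k nk]; last first.
    by rewrite /L [(k <= n)%N]leqNgt nk andbF.
  rewrite coef_sum [RHS]big_mkcond [LHS]big_mkcond; apply: eq_bigr => l _.
  rewrite /L (leq_ord l) andbT; case: (odd l) => //=; case: ifP; rewrite ?coef0 //.
have tl j : 2 * ((-1) ^+ j * q ^+ 'C(j.+1, 2) * two_inv1Dq q n.+1 j * qpoch_oddV q n.+1 j)
   = trunc (2 * (j == 0%N)%:R + 4 * L j.*2).
  rewrite rmorphD !rmorphM /= !rmorph_nat /L double_gt0.
  case: (posnP j) => [->|j0] /=.
    by rewrite /qpoch_oddV big_ord0 rmorph0 !(expr0, mulr1, mulr0, addr0).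
  rewrite mulr0 add0r; case: leqP => jn.
    rewrite trunc_largest // /two_inv1Dq; case: j j0 {jn} => // j _; ring.
  rewrite (_ : q ^+ 'C(j.+1, 2) = 0) ?(mulr0, mul0r, rmorph0) //.
  rewrite -truncX2 trunc_small // (leq_trans jn) // leq_double; exact: leq_bin2S.
pose s (y r : nat) : int := (if y == 0%N :> nat then 1 else 2) * (-1) ^+ y * 2 * (-1) ^+ r.
have tr (y r : nat) : sym_weight _ y * (-1) ^+ y * q ^+ (y ^ 2) *
     (2 * (-1) ^+ r * (q ^+ (r ^ 2) - q ^+ (r.+1 ^ 2))) =
   trunc ((s y r)%:~R * ('X^((y ^ 2 + r ^ 2).*2) - 'X^((y ^ 2 + r.+1 ^ 2).*2))).
  rewrite rmorphM rmorph_int rmorphB /= !truncX2 !exprD /s !rmorphM /= !rmorphXn /=.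
  rewrite !rmorphN1 -/(sym_weight _ y).
  rewrite (_ : sym_weight _ y = (if y == 0%N then 1 else 2 : int)%:~R).
    ring.
  by case: y.
have := theta_identity q_nilp; under eq_bigr do rewrite tl.
under [RHS]eq_bigr do rewrite big_distrr /=.
under [RHS]eq_bigr do under eq_bigr do rewrite tr.
under [RHS]eq_bigr do rewrite -rmorph_sum.
rewrite -!rmorph_sum => /(congr1 (fun p : trunc_ring => p`_n)).
rewrite !coef_trunc big_split /= -!big_distrr /= coefD.
have cM (k : nat) (p : {poly int}) : (k%:R * p)`_n = k%:R * p`_n.
  by rewrite !mulr_natl coefMn.
rewrite (cM 2%N) (cM 4%N) -p3L coef_sum [X in _ * X + _]big1 => [|j _]; last first.
  by case: eqP => _; rewrite ?coef0 // coef1 (gtn_eqF n0).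
rewrite mulr0 add0r => ->.
rewrite coef_sum; apply: eq_bigr => y _; rewrite coef_sum; apply: eq_bigr => r _.
by rewrite mulrzl coefMrz coefB !coefXn -mulrzl intz.
Qed.

Lemma theta_bound : (0 < n)%N ->
  `|p3 n| <= \sum_(y < n.+1) \sum_(r < n.+1)
     ((((y ^ 2 + r ^ 2).*2 == n) + ((y ^ 2 + r.+1 ^ 2).*2 == n))%N%:R : int).
Proof.
move=> n0; rewrite -(ler_pM2l (_ : (0 : int) < 4)) //.
have <- : `|4 * p3 n| = 4 * `|p3 n| by rewrite normrM.
rewrite theta_coef //.
apply: le_trans (ler_norm_sum _ _ _) _; rewrite mulr_sumr; apply: ler_sum => y _.
apply: le_trans (ler_norm_sum _ _ _) _; rewrite mulr_sumr.
pose B (r : nat) : int := 4 *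
  ((((y ^ 2 + r ^ 2).*2 == n) + ((y ^ 2 + r.+1 ^ 2).*2 == n))%N%:R).
have B0 r : 0 <= B r by rewrite mulr_ge0 // ler0n.
rewrite -[leRHS]/(\sum_(r < n.+1) B r) -(big_mkord xpredT B).
case: (leqP y.*2 n.+1) => yn; last first.
  by rewrite [leLHS]big_geq; [apply: sumr_ge0 | exact: ltnW].
rewrite [leRHS](big_cat_nat (n := y.*2)) //=; apply: ler_wpDl; first by apply: sumr_ge0.
apply: ler_sum => r _; rewrite /B !normrM !normrX normrN1 !expr1n !mulr1.
apply: ler_pM; [by rewrite mulr_ge0 | by [] | by case: ifP | ].
by rewrite (le_trans (ler_normB _ _)) // natrD !normr_nat ![n == _]eq_sym.
Qed.
End GenFun.

(** * Sums of two squares and primorials *)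

Section TwoSquares.
Local Open Scope nat_scope.

(** Otherwise x and y are prime to p, and x^2 + y^2 divides the sum of the odd powers
    (x^2)^((p-1)/2) + (y^2)^((p-1)/2), which is 2 modulo p by Fermat's little theorem. *)
Lemma dvdn_sum_sqr p x y : prime p -> p %% 4 = 3 -> p %| x ^ 2 + y ^ 2 -> p %| x.
Proof.
move=> pp p3 pxy; apply: contraT => px.
have py : ~~ (p %| y).
  apply: contra px => py; have py2 : p %| y ^ 2 by rewrite dvdn_exp.
  by move: pxy; rewrite dvdn_addl // Euclid_dvdX // => /andP[].
have fermat z : ~~ (p %| z) -> z ^ p.-1 = 1 %[mod p].
  move=> pz; rewrite -(totient_prime pp); apply: Euler_exp_totient.
  by rewrite coprime_sym prime_coprime.
pose k := p %/ 4; have pk : p.-1 = (2 * (2 * k).+1)%N by rewrite /k; lia.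
have : p %| (x ^ 2) ^ (2 * k).+1 + (y ^ 2) ^ (2 * k).+1.
  apply: dvdn_trans pxy _; move: (x ^ 2) (y ^ 2) => a b.
  elim: k {pk} => [|k IH]; first by rewrite muln0 !expn1.
  rewrite -(dvdn_addl _ (dvdn_mull (a * b ^ (2 * k).+1) (dvdnn (a + b)))).
  rewrite [X in _ %| X](_ : _ = a ^ 2 * (a ^ (2 * k).+1 + b ^ (2 * k).+1)
     + b ^ (2 * k).+2 * (a + b)).
    by rewrite dvdn_add // ?dvdn_mull.
  rewrite (_ : (2 * k.+1).+1 = (2 * k).+1.+2) ?mulnS //.
  rewrite !expnS; ring.
rewrite -!expnM -pk /dvdn -modnDm !fermat // modnDm.
by rewrite modn_small //; lia.
Qed.

(** If p divides the sum then it divides x and y, and one may divide both by p. *)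
Lemma sum_sqr_logn p x y : prime p -> p %% 4 = 3 -> 0 < x ^ 2 + y ^ 2 ->
  ~~ odd (logn p (x ^ 2 + y ^ 2)).
Proof.
move=> pp p3; have p0 := prime_gt0 pp.
move: {2}(_ + _).+1 (ltnSn (x ^ 2 + y ^ 2)) => N; elim: N x y => // N IH x y xyN xy0.
case: (boolP (p %| x ^ 2 + y ^ 2)) => [pxy|]; last first.
  by move=> npxy; rewrite lognE pp xy0 (negbTE npxy).
have /dvdnP[u ux] := dvdn_sum_sqr pp p3 pxy.
have /dvdnP[v vy] : p %| y by apply: (@dvdn_sum_sqr p y x) => //; rewrite addnC.
have E : x ^ 2 + y ^ 2 = p ^ 2 * (u ^ 2 + v ^ 2) by rewrite ux vy; ring.
have uv0 : 0 < u ^ 2 + v ^ 2 by move: xy0; rewrite E muln_gt0 => /andP[].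
rewrite E lognM ?expn_gt0 ?p0 // pfactorK // oddD /= IH //.
rewrite -ltnS (leq_trans _ xyN) // ltnS E ltn_Pmull //.
by rewrite (@leq_trans (1 ^ 2).+1) // ltn_exp2r // prime_gt1.
Qed.

(** The squarefree numbers all of whose prime factors split in the Gaussian integers. *)
Definition split_sqfree (e : nat) : bool :=
  (0 < e) && all (fun p => (p %% 4 == 1) && (logn p e == 1)) (primes e).

(** Remove squares of primes as long as possible; the remaining squarefree number has
    no prime factor congruent to 3 modulo 4 by the parity hypothesis, and the factor 2 is
    set apart. *)
Lemma even_logn_decomp n : 0 < n ->
  (forall p, prime p -> p %% 4 = 3 -> ~~ odd (logn p n)) ->
  exists d e, 0 < d /\ split_sqfree e /\ (n = d ^ 2 * e \/ n = 2 * (d ^ 2 * e)).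
Proof.
elim/ltn_ind: n => n IH n0 ev.
case: (boolP (has (fun p => p ^ 2 %| n) (primes n))) => [/hasP[p]|/hasPn sqf].
  rewrite mem_primes => /and3P[pp _ pn] /dvdnP[m mE].
  have p0 := prime_gt0 pp; have p1 := prime_gt1 pp.
  have m0 : 0 < m by move: n0; rewrite mE muln_gt0 => /andP[].
  have [||r rp r3|d [e [d0 [he hn]]]] := IH m.
  - by rewrite mE ltn_Pmulr // (@leq_trans (1 ^ 2).+1) // ltn_exp2r.
  - exact: m0.
  - move: (ev r rp r3); rewrite mE lognM ?expn_gt0 ?p0 // lognX mul2n oddD odd_double addbF //.
  - exists (d * p), e; split; first by rewrite muln_gt0 d0.
    split => //; rewrite mE; case: hn => ->; [left|right]; ring.
have lg1 p : prime p -> p %| n -> logn p n = 1.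
  move=> pp pn; have pP : p \in primes n by rewrite mem_primes pp n0.
  have := sqf p pP; rewrite pfactor_dvdn // -ltnNge.
  have := logn_gt0 p n; rewrite pP; lia.
have pmod4 p : prime p -> p %| n -> p = 2 \/ p %% 4 = 1.
  move=> pp pn; case: (even_prime pp) => [->|op]; [by left|right].
  case: (eqVneq (p %% 4) 3) => [p3|p3]; last by move: (ltn_pmod p (isT : 0 < 4)); lia.
  by have := ev p pp p3; rewrite lg1.
case: (boolP (2 %| n)) => [n2|n2]; last first.
  exists 1, n; split => //; split; last by left; rewrite mul1n.
  rewrite /split_sqfree n0; apply/allP => p; rewrite mem_primes => /and3P[pp _ pn].
  rewrite lg1 // eqxx andbT; case: (pmod4 p pp pn) => [p2|->//].
  by rewrite -p2 pn in n2.
case/dvdnP: (n2) => e nE.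
have e0 : 0 < e by move: n0; rewrite nE muln_gt0 => /andP[].
exists 1, e; split => //; split; last by right; rewrite mul1n mulnC.
rewrite /split_sqfree e0; apply/allP => p; rewrite mem_primes => /and3P[pp _ pe].
have pn : p %| n by rewrite nE dvdn_mulr.
have := lg1 p pp pn; rewrite nE lognM // => lgp.
have lge : 0 < logn p e by rewrite logn_gt0 mem_primes pp e0.
case: (pmod4 p pp pn) => [p2|->]; last by rewrite eqxx /=; apply/eqP; lia.
by move: lgp lge; rewrite p2 (pfactorK 1) //; lia.
Qed.
End TwoSquares.

Section Primorial.
Local Open Scope nat_scope.

Lemma bin_odd_le m : 'C(m.*2.+1, m) <= 4 ^ m.
Proof.
have h : 'C(m.*2.+1, m) + 'C(m.*2.+1, m.+1) <= 2 ^ m.*2.+1.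
  rewrite -[2]/(1 + 1) Pascal.
  rewrite (bigD1 (inord m)) //= (bigD1 (inord m.+1)) /=; last first.
    by rewrite -val_eqE /= !inordK //; lia.
  rewrite !inordK ?exp1n ?muln1; [|lia..].
  by rewrite ?exp1n ?muln1 addnA leq_addr.
have e : 'C(m.*2.+1, m.+1) = 'C(m.*2.+1, m).
  rewrite -bin_sub; last by lia.
  by congr 'C(_, _); lia.
have e2 : 2 ^ m.*2.+1 = 2 * 4 ^ m by rewrite expnS -mul2n expnM.
by move: h; rewrite e e2 addnn -mul2n leq_pmul2l.
Qed.

Lemma prod_primes_dvdn a b N :
  (forall p, a <= p < b -> prime p -> p %| N) ->
  \prod_(a <= p < b | prime p) p %| N.
Proof.
elim: b => [|b IH] pN; first by rewrite big_geq.
case: (leqP a b) => ab; last by rewrite big_geq.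
rewrite big_mkcond big_nat_recr //= -big_mkcond /=.
case: ifP => pb; last by rewrite muln1 IH // => p /andP[? ?]; apply: pN; lia.
rewrite Gauss_dvd.
  rewrite IH ?pN ?ab ?leqnn //= => p /andP[? ?]; apply: pN; lia.
rewrite coprime_sym prime_coprime // big_seq_cond.
apply: (big_ind (fun x => ~~ (b %| x))).
- by rewrite dvdn1; apply: contraTN pb => /eqP ->.
- by move=> x y hx hy; rewrite Euclid_dvdM // negb_or hx.
- move=> p /andP[]; rewrite mem_index_iota => /andP[ap pb'] pp.
  by rewrite dvdn_prime2 // eq_sym ltn_eqF.
Qed.

(** The primes in the interval (m+1, 2m+1] divide the binomial coefficient
    C(2m+1, m), which is at most 4^m. *)
Lemma primorial_le n : \prod_(0 <= p < n.+1 | prime p) p <= 4 ^ n.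
Proof.
elim/ltn_ind: n => n IH; case: (ltnP n 3) => n3.
  by case: n n3 {IH} => [|[|[|]]] // _; rewrite unlock.
case: (boolP (odd n)) => on; last first.
  rewrite big_mkcond big_nat_recr //= -big_mkcond /= ifN ?muln1; last first.
    by apply: contra on => /even_prime[n2|//]; rewrite n2 in n3.
  case: n IH n3 {on} => // n IH _; apply: leq_trans (IH n _) _ => //.
  by rewrite leq_exp2l.
pose m := n./2; have nE : n = m.*2.+1 by rewrite -[LHS]odd_double_half on.
have m0 : 0 < m by lia.
rewrite nE (big_cat_nat (n := m.+2)) //=; last by lia.
apply: (@leq_trans (4 ^ m.+1 * 4 ^ m)); last by rewrite -expnD leq_exp2l; lia.
apply: leq_mul; first by apply: IH; lia.
apply: leq_trans (bin_odd_le m).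
apply: dvdn_leq; first by rewrite bin_gt0; lia.
apply: prod_primes_dvdn => p /andP[mp pn] pp.
have fact_lt k : k < p -> ~~ (p %| k`!).
  elim: k => [|k IHk] kp; first by rewrite fact0 dvdn1 neq_ltn prime_gt1 ?orbT.
  rewrite factS Euclid_dvdM // negb_or IHk 1?ltnW // andbT.
  by apply/negP => /dvdn_leq; lia.
have : p %| (m.*2.+1)`! by rewrite dvdn_fact // prime_gt0.
rewrite -(@bin_fact _ m); last by lia.
rewrite !Euclid_dvdM // (negbTE (fact_lt m _)) ?(negbTE (fact_lt (_ - m) _)) ?orbF //; lia.
Qed.
End Primorial.

(** * The character modulo 4 and harmonic sums *)

(** The nontrivial Dirichlet character modulo 4. *)
Definition chi4 (d : nat) : int :=
  if (d %% 4 == 1)%N then 1 else if (d %% 4 == 3)%N then -1 else 0.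

Lemma chi4M a b : chi4 (a * b) = chi4 a * chi4 b.
Proof.
rewrite /chi4 -modnMm; have := ltn_pmod a (isT : 0 < 4)%N; have := ltn_pmod b (isT : 0 < 4)%N.
by case: (a %% 4)%N => [|[|[|[|]]]] //; case: (b %% 4)%N => [|[|[|[|]]]].
Qed.

(** The convolution of [chi4] with the constant function 1, a quarter of the number of
    representations as a sum of two squares. It is the number of divisors when all of
    them are congruent to 1 modulo 4. *)
Definition chi4_sum (n : nat) : int := \sum_(d <- divisors n) chi4 d.

(** The divisors of p^(a+1) m that are not multiples of p^(a+1) are those of p^a m. *)
Lemma perm_divisors_pfactor p a m : prime p -> (0 < m)%N -> ~~ (p %| m)%N ->
  perm_eq (divisors (p ^ a.+1 * m))
          (divisors (p ^ a * m) ++ [seq (p ^ a.+1 * e)%N | e <- divisors m]).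
Proof.
move=> pp m0 pm; have p0 := prime_gt0 pp.
have pa0 k : (0 < p ^ k)%N by rewrite expn_gt0 p0.
apply: uniq_perm; first exact: divisors_uniq.
  rewrite cat_uniq divisors_uniq map_inj_uniq ?divisors_uniq; last first.
    by move=> x y /eqP; rewrite eqn_pmul2l // => /eqP.
  rewrite andbT /=; apply/hasPn => _ /mapP[e _ ->].
  rewrite -dvdn_divisors ?muln_gt0 ?pa0 //; apply: contra pm => h.
  have := dvdn_trans (dvdn_mulr e (dvdnn (p ^ a.+1))) h.
  by rewrite expnSr dvdn_pmul2l.
move=> d; rewrite mem_cat -!dvdn_divisors ?muln_gt0 ?pa0 //.
apply/idP/orP => [dn|[dn|/mapP[e]]]; last 2 first.
- by apply: dvdn_trans dn _; rewrite dvdn_pmul2r // dvdn_exp2l.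
- by rewrite -dvdn_divisors // => em ->; rewrite dvdn_pmul2l.
case: (boolP (p ^ a.+1 %| d)%N) => [/dvdnP[e dE]|npd].
  right; apply/mapP; exists e; last by rewrite dE mulnC.
  by rewrite -dvdn_divisors //; move: dn; rewrite dE mulnC dvdn_pmul2l.
left; have d0 : (0 < d)%N by apply: dvdn_gt0 dn; rewrite muln_gt0 pa0.
have [e pe dE] := pfactor_coprime pp d0.
move: npd dn; rewrite pfactor_dvdn // -leqNgt => la dn.
rewrite dE mulnC dvdn_mul ?dvdn_exp2l //.
have : (e %| p ^ a.+1 * m)%N by apply: dvdn_trans dn; rewrite dE dvdn_mulr.
by rewrite Gauss_dvdr // coprime_sym coprimeXl.
Qed.

Lemma chi4_sum_pfactor p a m : prime p -> (0 < m)%N -> ~~ (p %| m)%N ->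
  chi4_sum (p ^ a * m) = (\sum_(i < a.+1) chi4 p ^+ i) * chi4_sum m.
Proof.
move=> pp m0 pm; have chiX k : chi4 (p ^ k) = chi4 p ^+ k.
  by elim: k => // k IH; rewrite expnS chi4M IH exprS.
elim: a => [|a IH]; first by rewrite mul1n big_ord_recl big_ord0 addr0 mul1r.
rewrite /chi4_sum (perm_big _ (perm_divisors_pfactor a pp m0 pm)) big_cat.
rewrite -/(chi4_sum (p ^ a * m)) IH big_map [in RHS]big_ord_recr /= mulrDl; congr (_ + _).
by rewrite big_distrr /=; apply: eq_bigr => e _; rewrite chi4M chiX.
Qed.

Lemma chi4_sum_ge0 n : (0 < n)%N -> 0 <= chi4_sum n.
Proof.
elim/ltn_ind: n => n IH n0; case: (ltnP 1 n) => n1; last first.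
  have -> : n = 1%N by lia.
  by rewrite /chi4_sum /= big_seq1.
have pp := pdiv_prime n1; have [m pm nE] := pfactor_coprime pp n0.
have m0 : (0 < m)%N by move: n0; rewrite nE muln_gt0 => /andP[].
have l0 : (0 < logn (pdiv n) n)%N by rewrite logn_gt0 mem_primes pp n0 pdiv_dvd.
rewrite nE mulnC chi4_sum_pfactor //; last by rewrite -prime_coprime.
apply: mulr_ge0; last first.
  apply: (IH m _ m0); rewrite [ltnRHS]nE ltn_Pmulr //.
  by rewrite -(exp1n (logn (pdiv n) n)) ltn_exp2r // prime_gt1.
move: (logn (pdiv n) n) => k; rewrite /chi4; case: ifP => _.
  by apply: sumr_ge0 => i _; rewrite expr1n.
case: ifP => _; last by apply: sumr_ge0 => i _; apply: exprn_ge0.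
suff : \sum_(i < k.+1) (-1) ^+ i = (~~ odd k)%:R :> int by move=> ->.
elim: k => [|k IHk]; first by rewrite big_ord_recl big_ord0.
by rewrite big_ord_recr IHk /= -signr_odd /=; case: (odd k).
Qed.

Lemma chi4_sum_split n : (0 < n)%N ->
  (forall p, prime p -> (p %| n)%N -> p %% 4 = 1)%N ->
  chi4_sum n = (size (divisors n))%:R.
Proof.
move=> n0 sp; have chi1 d : (d %| n)%N -> chi4 d = 1.
  elim/ltn_ind: d => d IH dn; case: (ltnP 1 d) => d1; last first.
    have := dvdn_gt0 n0 dn => d0; have -> // : d = 1%N by lia.
  have pp := pdiv_prime d1; have /dvdnP[e dE] := pdiv_dvd d.
  have ed : (e < d)%N.
    by rewrite [ltnRHS]dE ltn_Pmulr ?prime_gt1 //; case: (e) dE d1 => // ->.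
  rewrite dE chi4M IH ?mul1r //; last first.
    by apply: dvdn_trans dn; rewrite dE dvdn_mulr.
  by rewrite /chi4 sp //; apply: dvdn_trans dn; exact: pdiv_dvd.
rewrite /chi4_sum big_seq (eq_bigr (fun=> 1)) => [|d]; last first.
  by rewrite -dvdn_divisors //; exact: chi1.
by rewrite -big_seq -sum1_size natr_sum.
Qed.

Section Harmonic.
Variable R : realFieldType.

Definition harmonic_sum (n : nat) : R := \sum_(1 <= k < n.+1) k%:R^-1.

Lemma sum_multiples (d X : nat) : (0 < d)%N ->
  \sum_(1 <= n < X.+1 | (d %| n)%N) n%:R^-1 = d%:R^-1 * harmonic_sum (X %/ d) :> R.
Proof.
move=> d0; elim: X => [|X IH]; first by rewrite div0n /harmonic_sum !big_geq ?mulr0.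
rewrite big_mkcond big_nat_recr //= -big_mkcond IH /= divnS //.
case: ifP => dX; rewrite ?addr0 ?add0n // add1n.
rewrite [in RHS]/harmonic_sum big_nat_recr //= mulrDr -/(harmonic_sum _); congr (_ + _).
by rewrite -invfM -natrM -[in RHS]add1n -[1%N in RHS]/(true : nat) -dX -divnS // mulnC divnK.
Qed.

(** The partial sums of [chi4] are 0 or 1; summation by parts leaves a telescoping sum
    of the decrements of g, bounded by g(1). *)
Lemma chi4_alternating (g : nat -> R) (X : nat) :
  (forall d, (0 < d)%N -> 0 <= g d.+1 <= g d) -> (0 < X)%N ->
  \sum_(1 <= d < X.+1) (chi4 d)%:~R * g d <= g 1%N.
Proof.
move=> g_mono X0; pose S (n : nat) : int := \sum_(1 <= d < n.+1) chi4 d.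
have S01 n : S n = (if (n %% 4 == 1)%N || (n %% 4 == 2)%N then 1 else 0).
  elim: n => [|n IH]; first by rewrite /S big_geq.
  rewrite /S big_nat_recr //= -/(S n) IH /chi4.
  have -> : (n.+1 %% 4 = (n %% 4).+1 %% 4)%N by rewrite -addn1 -modnDml addn1.
  have := ltn_pmod n (isT : 0 < 4)%N.
  by case: (n %% 4)%N => [|[|[|[|]]]].
have S1 n : (0 < n)%N -> (S n)%:~R * g n <= g n /\ 0 <= (S n)%:~R * g n.
  move=> n0; have gn : 0 <= g n.
    by have /andP[h1 h2] := g_mono n n0; exact: le_trans h1 h2.
  by rewrite S01; case: ifP => _; rewrite ?mul1r ?mul0r.
suff H n : (0 < n)%N ->
    \sum_(1 <= d < n.+1) (chi4 d)%:~R * g d <= g 1%N - g n + (S n)%:~R * g n.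
  apply: le_trans (H X X0) _; have [h _] := S1 X X0.
  by rewrite -addrA gerDl addrC subr_le0.
case: n => // n _; elim: n => [|n IH].
  by rewrite big_nat1 subrr add0r /S big_nat1.
rewrite big_nat_recr //=; apply: le_trans (lerD IH (lexx _)) _.
rewrite [S n.+2]/S big_nat_recr //= -/(S n.+1) rmorphD /= mulrDl.
rewrite addrA lerD2r -!addrA lerD2l.
have /andP[_ gS] := g_mono n.+1 isT.
rewrite S01; case: ifP => _; rewrite ?mul1r ?mul0r ?addr0 ?subrr ?addNr //.
by rewrite lerN2.
Qed.

Lemma harmonic_sum_mono m n : (m <= n)%N -> harmonic_sum m <= harmonic_sum n.
Proof.
move=> mn; rewrite /harmonic_sum [leRHS](big_cat_nat (n := m.+1)) //= lerDl.
by rewrite sumr_ge0 // => k _; rewrite invr_ge0 ler0n.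
Qed.

Lemma harmonic_sum_ge0 m : 0 <= harmonic_sum m.
Proof. by rewrite sumr_ge0 // => k _; rewrite invr_ge0 ler0n. Qed.

(** Exchange the summation over n with the one over its divisors d. The inner sum
    over the multiples of d is nonincreasing in d, so that [chi4_alternating] bounds the whole
    by its value at d = 1. *)
Lemma chi4_sum_mean (X : nat) : (0 < X)%N ->
  \sum_(1 <= n < X.+1) (chi4_sum n)%:~R / n%:R <= harmonic_sum X.
Proof.
move=> X0.
have -> : \sum_(1 <= n < X.+1) (chi4_sum n)%:~R / n%:R =
   \sum_(1 <= d < X.+1) (chi4 d)%:~R * (d%:R^-1 * harmonic_sum (X %/ d)) :> R.
  under [RHS]eq_big_nat => d /andP[d0 _].
    rewrite -sum_multiples // big_distrr /= big_mkcond. over.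
  rewrite exchange_big_nat /=; apply: eq_big_nat => n /andP[n0 nX].
  rewrite /chi4_sum rmorph_sum big_distrl /= -big_mkcond /=.
  rewrite -[in RHS]big_filter; apply: perm_big.
  apply: uniq_perm; rewrite ?divisors_uniq ?filter_uniq ?iota_uniq // => d.
  rewrite mem_filter mem_index_iota -dvdn_divisors //.
  case: (boolP (d %| n)%N) => //= dn.
  by rewrite (dvdn_gt0 n0 dn) ltnS (leq_trans (dvdn_leq n0 dn)).
apply: le_trans (chi4_alternating _ X0) _; last by rewrite divn1 invr1 mul1r.
move=> d d0; have dV k : 0 <= k%:R^-1 :> R by rewrite invr_ge0 ler0n.
rewrite mulr_ge0 ?harmonic_sum_ge0 //=; apply: ler_pM; rewrite ?harmonic_sum_ge0 ?dV //.
  by rewrite lef_pV2 ?posrE ?ltr0n // ler_nat.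
by apply: harmonic_sum_mono; apply: leq_div2l.
Qed.

(** Expand the square as a sum over n = e f. All divisors of such an n are congruent to
    1 modulo 4, so the number of factorisations is at most [chi4_sum n]; the other n
    contribute nonnegatively to [chi4_sum_mean]. *)
Lemma split_harmonic_sqr (M : nat) : (0 < M)%N ->
  (\sum_(e < M.+1 | split_sqfree e) e%:R^-1) ^+ 2 <= harmonic_sum (M ^ 2) :> R.
Proof.
move=> M0; apply: le_trans (chi4_sum_mean _); last by rewrite expn_gt0 M0.
pose X := (M ^ 2)%N; pose c (n : nat) : R :=
  \sum_(e < M.+1 | split_sqfree e) \sum_(f < M.+1 | split_sqfree f) (e * f == n)%N%:R.
have -> : (\sum_(e < M.+1 | split_sqfree e) e%:R^-1) ^+ 2 =
    \sum_(1 <= n < X.+1) c n / n%:R :> R.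
  rewrite expr2 big_distrl /=.
  under [RHS]eq_bigr do rewrite big_distrl /=.
  rewrite [RHS]exchange_big /=; apply: eq_bigr => e se; rewrite big_distrr /=.
  under [RHS]eq_bigr do rewrite big_distrl /=.
  rewrite [RHS]exchange_big /=; apply: eq_bigr => f sf.
  rewrite (bigD1_seq (e * f)%N) ?iota_uniq //=; last first.
    rewrite mem_index_iota ltnS muln_gt0.
    have /andP[-> _] := se; have /andP[-> _] := sf.
    by rewrite /X -mulnn leq_mul // -ltnS.
  rewrite eqxx mul1r big1 => [|n /negbTE]; last by rewrite eq_sym => ->; rewrite mul0r.
  by rewrite addr0 natrM invfM.
apply: ler_sum_nat => n /andP[n0 nX]; apply: ler_wpM2r; first by rewrite invr_ge0 ler0n.
have c_div : c n <= (size (divisors n))%:R.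
  have fib (e : 'I_M.+1) : split_sqfree e ->
      \sum_(f < M.+1 | split_sqfree f) (e * f == n)%N%:R <= (e %| n)%:R :> R.
    case/andP=> e0 _.
    case: (pickP (fun f : 'I_M.+1 => split_sqfree f && (e * f == n)%N)) => [f0|nof].
      case/andP=> sf0 /eqP ef0; rewrite (bigD1 f0) //= ef0 eqxx big1 ?addr0 => [|f].
        by rewrite -ef0 dvdn_mulr.
      case/andP=> _ ff0; rewrite -ef0 eqn_pmul2l // (_ : (f == f0 :> nat) = false) //.
      exact/negbTE.
    by rewrite big1 => [|f sf]; [exact: ler0n | have := nof f; rewrite sf /= => ->].
  apply: le_trans (ler_sum _ fib) _; rewrite -natr_sum ler_nat.
  rewrite -(big_mkord (fun e => split_sqfree e) (fun e => nat_of_bool (e %| n)%N)).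
  rewrite -big_mkcondr /= -big_filter sum1_size; apply: uniq_leq_size.
    by rewrite filter_uniq ?iota_uniq.
  by move=> e; rewrite mem_filter -dvdn_divisors // => /andP[/andP[]].
case: (boolP [exists e : 'I_M.+1, exists f : 'I_M.+1,
        [&& split_sqfree e, split_sqfree f & e * f == n]%N]).
  case/existsP=> e /existsP[f /and3P[se sf /eqP efn]].
  rewrite chi4_sum_split ?rmorph_nat //.
  have sp g p : split_sqfree g -> prime p -> (p %| g)%N -> (p %% 4 = 1)%N.
    case/andP=> g0 /allP h pp pg; have /h : p \in primes g by rewrite mem_primes pp g0.
    by case/andP=> /eqP.
  move=> p pp; rewrite -efn Euclid_dvdM // => /orP[]; exact: sp.
move=> /existsPn nex; suff -> : c n = 0 by rewrite ler0z chi4_sum_ge0.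
apply: big1 => e se; apply: big1 => f sf; case: eqP => // efn.
by have := nex e; move/existsPn/(_ f); rewrite se sf efn eqxx.
Qed.
End Harmonic.

(** * Logarithmic counting of squarefree numbers with split primes *)

Lemma ler_sum_inj (R : numDomainType) (I J : finType) (P : pred I) (Q : pred J)
    (h : I -> J) (f : I -> R) (g : J -> R) :
  (forall i j, P i -> P j -> h i = h j -> i = j) ->
  (forall i, P i -> Q (h i) /\ f i <= g (h i)) ->
  (forall j, Q j -> 0 <= g j) -> \sum_(i | P i) f i <= \sum_(j | Q j) g j.
Proof.
move=> hinj hP g0; apply: (@le_trans _ _ (\sum_(i | P i) g (h i))).
  by apply: ler_sum => i /hP[].
rewrite -(big_imset (h := h) (A := P)) /=; last by move=> i j; exact: hinj.
rewrite [leRHS](bigID [in h @: P]) /= ler_wpDr ?sumr_ge0 //.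
  by move=> j /andP[/g0].
rewrite le_eqVlt; apply/orP; left; apply/eqP/eq_bigl => j.
by case: imsetP => [[i Pi ->]|_]; rewrite ?andbF // andbT; case: (hP i Pi) => ->.
Qed.

Lemma split_sqfree_dvd m e : (m %| e)%N -> split_sqfree e -> split_sqfree m.
Proof.
move=> me /andP[e0 /allP he]; have m0 := dvdn_gt0 e0 me.
rewrite /split_sqfree m0; apply/allP => p; rewrite mem_primes => /and3P[pp _ pm].
have /he/andP[-> /eqP l1] /= : p \in primes e by rewrite mem_primes pp e0 (dvdn_trans pm).
have := dvdn_leq_log p e0 me; have : (0 < logn p m)%N by rewrite logn_gt0 mem_primes pp m0.
by lia.
Qed.

Section LogSums.
Variable R : realType.
Local Notation ln := (@ln R).

Lemma ln_prod (I : Type) (r : seq I) (P : pred I) (F : I -> R) :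
  (forall i, P i -> 0 < F i) -> ln (\prod_(i <- r | P i) F i) = \sum_(i <- r | P i) ln (F i).
Proof.
move=> F0; elim: r => [|i r IH]; first by rewrite !big_nil ln1.
by rewrite !big_cons; case: ifP => // Pi; rewrite lnM ?posrE ?F0 ?prodr_gt0 // IH.
Qed.

Lemma ln_le_sub1 (x : R) : 0 < x -> ln x <= x - 1.
Proof. by move=> x0; rewrite -{1}[x](subrKC 1); apply: le_ln1Dx; lra. Qed.

Lemma harmonic_sum_ln n : (0 < n)%N -> harmonic_sum R n <= 1 + ln n%:R.
Proof.
case: n => // n _; elim: n => [|n IH]; first by rewrite /harmonic_sum big_nat1 invr1 ln1 addr0.
rewrite /harmonic_sum big_nat_recr //= -/(harmonic_sum R n.+1).
apply: le_trans (lerD IH (lexx _)) _; rewrite -addrA lerD2l.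
have n1 : 0 < n.+1%:R :> R by rewrite ltr0n.
have n2 : 0 < n.+2%:R :> R by rewrite ltr0n.
rewrite -lerBrDl -lerN2 opprB -ln_div ?posrE //.
apply: le_trans (ln_le_sub1 _) _; first by rewrite divr_gt0.
rewrite le_eqVlt; apply/orP; left; apply/eqP.
rewrite (_ : n.+1%:R = n.+2%:R - 1 :> R); last by rewrite -(natr1 n.+1) addrK.
field; lra.
Qed.

Lemma sum_invsqr_le2 n : \sum_(1 <= d < n.+1) (d%:R ^+ 2)^-1 <= 2 :> R.
Proof.
case: n => [|n]; first by rewrite big_geq.
apply: (@le_trans _ _ (2 - n.+1%:R^-1)); last by rewrite gerBl invr_ge0.
elim: n => [|n IH]; first by rewrite big_nat1 expr1n invr1; lra.
rewrite big_nat_recr //=; apply: le_trans (lerD IH (lexx _)) _.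
have n1 : 0 < n.+1%:R :> R by rewrite ltr0n.
rewrite -(natr1 n.+1); move: (n.+1%:R) n1 => x x0.
rewrite -subr_ge0.
have -> : 2 - (x + 1)^-1 - (2 - x^-1 + ((x + 1) ^+ 2)^-1) = (x * (x + 1) ^+ 2)^-1.
  by field; lra.
by rewrite invr_ge0; apply: mulr_ge0; [lra | apply: exprn_ge0; lra].
Qed.

(** The terms are dominated by the decrements of (log x + 2)/x. *)
Lemma sum_ln_invsqr_le2 n : \sum_(1 <= d < n.+1) ln d%:R / d%:R ^+ 2 <= 2.
Proof.
case: n => [|n]; first by rewrite big_geq.
apply: (@le_trans _ _ (2 - (ln n.+1%:R + 2) / n.+1%:R)); last first.
  by rewrite gerBl divr_ge0 // addr_ge0 // ln_ge0 // ler1n.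
elim: n => [|n IH]; first by rewrite big_nat1 expr1n ln1; lra.
rewrite big_nat_recr //=; apply: le_trans (lerD IH (lexx _)) _.
have n1 : 1 <= n.+1%:R :> R by rewrite ler1n.
rewrite -(natr1 n.+1); move: (n.+1%:R) n1 => x x1.
have lx : ln (x + 1) <= ln x + 1 / x.
  have x0 : 0 < x by lra.
  rewrite -lerBlDl -ln_div ?posrE //; last by lra.
  apply: le_trans (ln_le_sub1 _) _; first by rewrite divr_gt0 //; lra.
  rewrite le_eqVlt; apply/orP; left; apply/eqP; field; lra.
have l0 : 0 <= ln x by apply: ln_ge0.
have x0 : 0 < x by lra.
have le1 : 1 / x <= 1 by rewrite ler_pdivrMr //; lra.
rewrite -subr_ge0.
set a := ln (x + 1) in lx *; set b := ln x in lx l0 *.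
have -> : 2 - (a + 2) / (x + 1) - (2 - (b + 2) / x + a / (x + 1) ^+ 2)
  = (b + x + (b + 1 / x - a) * (x ^+ 2 + 2 * x)) / (x * (x + 1) ^+ 2).
  field; lra.
apply: divr_ge0; last by apply: mulr_ge0; [lra | apply: exprn_ge0; lra].
apply: addr_ge0; first lra.
by apply: mulr_ge0; [lra | apply: addr_ge0; [apply: exprn_ge0; lra | lra]].
Qed.

(** Chebyshev's upper bound for the sum of log p over the primes up to m. *)
Lemma ln_primes_sum_le m : \sum_(p < m.+1 | prime p) ln p%:R <= 3 * m%:R.
Proof.
rewrite -ln_prod => [|p pp]; last by rewrite ltr0n prime_gt0.
rewrite -(big_mkord prime (fun p => p%:R)) -natr_prod.
have P0 : (0 < \prod_(0 <= p < m.+1 | prime p) p)%N.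
  by apply: prodn_cond_gt0 => p; exact: prime_gt0.
apply: (@le_trans _ _ (ln (4 ^+ m))).
  by rewrite ler_ln ?posrE ?ltr0n ?exprn_gt0 // -natrX ler_nat primorial_le.
rewrite lnXn // -[_ *+ m]mulr_natr; apply: ler_wpM2r; first exact: ler0n.
have := @ln_le_sub1 4; lra.
Qed.

(** The number of pairs (d, e) with d^2 e <= M. Pairs are easier to count than the
    values d^2 e, and suffice for an upper bound. *)
Definition sqfree_pairs (M : nat) : R :=
  \sum_(1 <= d < M.+1) \sum_(e < M.+1 | split_sqfree e) (d ^ 2 * e <= M)%N%:R.

Definition split_harmonic (M : nat) : R := \sum_(e < M.+1 | split_sqfree e) e%:R^-1.

Lemma ln_split_sqfree M e : split_sqfree e -> (e <= M)%N ->
  ln e%:R = \sum_(p < M.+1 | prime p && (p %| e)%N) ln p%:R.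
Proof.
case/andP=> e0 /allP he eM.
have := widen_partn predT eM; rewrite partnT // => {1}->.
rewrite natr_prod ln_prod => [|p _]; last first.
  rewrite ltr0n expn_gt0; case: p => //.
rewrite big_mkord /= [RHS]big_mkcond /=; apply: eq_bigr => p _.
case: ifP => [/andP[pp pe]|/negbT np].
  by have /he/andP[_ /eqP ->] : (p : nat) \in primes e; rewrite ?expn1 // mem_primes pp e0.
suff -> : logn p e = 0%N by rewrite expn0 ln1.
by rewrite lognE; case: ifP => // /and3P[pp _ pe]; rewrite pp pe in np.
Qed.

(** Write log e as the sum of log p over the primes p dividing e, and e = m p. For
    fixed d and m the primes run up to M/(d^2 m), so that Chebyshev's bound gives
    3 M/(d^2 m), and the sum over m is the harmonic one. *)
Lemma split_prime_part M d : (0 < d)%N ->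
  \sum_(e < M.+1 | split_sqfree e) (d ^ 2 * e <= M)%N%:R * ln e%:R
  <= 3 * M%:R / d%:R ^+ 2 * split_harmonic M.
Proof.
move=> d0; have d20 : (0 < d ^ 2)%N by rewrite expn_gt0 d0.
under eq_bigr => e se.
  rewrite (ln_split_sqfree se (leq_ord e)) big_distrr /=.
  rewrite big_mkcondr /=; over.
rewrite exchange_big /=.
apply: (@le_trans _ _ (\sum_(p < M.+1 | prime p) \sum_(m < M.+1 | split_sqfree m)
    (d ^ 2 * m * p <= M)%N%:R * ln p%:R)).
  apply: ler_sum => p pp; rewrite -big_mkcondr /=.
  have p0 := prime_gt0 pp.
  (* removing the prime p is injective on the multiples of p *)
  pose h (e : 'I_M.+1) : 'I_M.+1 := inord (e %/ p).
  have hE (e : 'I_M.+1) : h e = (e %/ p)%N :> nat.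
    by rewrite inordK // ltnS (leq_trans (leq_div _ _)) ?leq_ord.
  apply: (ler_sum_inj (h := h)).
  - move=> e f /andP[_ pe] /andP[_ pf] /(congr1 (@nat_of_ord _)).
    by rewrite !hE => ef; apply/val_inj; rewrite /= -(divnK pe) -(divnK pf) ef.
  - move=> e /andP[se pe]; rewrite hE -mulnA divnK //; split => //.
    by apply: (split_sqfree_dvd _ se); apply/dvdnP; exists p; rewrite mulnC divnK.
  - move=> m _; apply: mulr_ge0; first exact: ler0n.
    by apply: ln_ge0; rewrite ler1n.
rewrite exchange_big /= /split_harmonic big_distrr /=.
apply: ler_sum => m sm; have /andP[m0 _] := sm.
have dm0 : (0 < d ^ 2 * m)%N by rewrite muln_gt0 d20.
pose k := (M %/ (d ^ 2 * m))%N.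
have kM : (k <= M)%N by apply: leq_div.
apply: (@le_trans _ _ (\sum_(p < k.+1 | prime p) ln p%:R)).
  rewrite [leRHS](big_ord_widen_cond M.+1 (fun p => prime p) (fun p => ln p%:R)) //.
  rewrite [leRHS]big_mkcondr /=. apply: ler_sum => p pp.
  rewrite ltnS /k leq_divRL // [(p * _)%N]mulnC.
  by case: leqP; rewrite ?mul1r ?mul0r.
apply: le_trans (ln_primes_sum_le _) _; rewrite -!mulrA ler_pM2l //.
apply: (@le_trans _ _ (M%:R / (d ^ 2 * m)%:R)).
  by rewrite ler_pdivlMr ?ltr0n // -natrM ler_nat leq_trunc_div.
by rewrite natrM natrX invfM.
Qed.

(** Each pair is weighted by log M = log (M/(d^2 e)) + 2 log d + log e, where the
    first summand is at most M/(d^2 e). The last one is [split_prime_part]; the sums over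
    d converge. *)
Lemma sqfree_pairs_le M : (0 < M)%N ->
  sqfree_pairs M * ln M%:R <= 12 * M%:R * split_harmonic M.
Proof.
move=> M0; have MR : 0 < M%:R :> R by rewrite ltr0n.
have H1 : 1 <= split_harmonic M.
  rewrite /split_harmonic (bigD1 (inord 1)) /=; last by rewrite inordK.
  by rewrite inordK // invr1 lerDl sumr_ge0 // => e _; rewrite invr_ge0 ler0n.
have H0 : 0 <= split_harmonic M by lra.
apply: (@le_trans _ _ (\sum_(1 <= d < M.+1) (4 * M%:R * split_harmonic M * (d%:R ^+ 2)^-1
   + 2 * M%:R * (ln d%:R / d%:R ^+ 2)))); last first.
  rewrite big_split -!big_distrr /=.
  have h1 := sum_invsqr_le2 M; have h2 := sum_ln_invsqr_le2 M.
  apply: (@le_trans _ _ (4 * M%:R * split_harmonic M * 2 + 2 * M%:R * 2)).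
    by apply: lerD; apply: ler_wpM2l => //; rewrite ?mulr_ge0 // ?ler0n.
  have : M%:R * 1 <= M%:R * split_harmonic M by rewrite ler_pM2l.
  lra.
rewrite /sqfree_pairs big_distrl /=; apply: ler_sum_nat => d /andP[d0 dM].
have dR : 1 <= d%:R :> R by rewrite ler1n.
have d20 : (0 < d ^ 2)%N by rewrite expn_gt0 d0.
have d2R : 0 < d%:R ^+ 2 :> R by rewrite exprn_gt0 // ltr0n.
have ld : 0 <= ln d%:R by apply: ln_ge0.
apply: (@le_trans _ _ (\sum_(e < M.+1 | split_sqfree e)
   (M%:R / d%:R ^+ 2 * e%:R^-1 + (d ^ 2 * e <= M)%N%:R * (2 * ln d%:R)
    + (d ^ 2 * e <= M)%N%:R * ln e%:R))).
  rewrite big_distrl /=; apply: ler_sum => e /andP[e0 _].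
  have eR : 0 < e%:R :> R by rewrite ltr0n.
  case: leqP => le; rewrite ?mul0r ?mul1r ?addr0; last first.
    by rewrite mulr_ge0 ?invr_ge0 // divr_ge0 // ltW.
  set q := M%:R / d%:R ^+ 2 * e%:R^-1.
  have q0 : 0 < q by apply: divr_gt0 => //; apply: divr_gt0.
  have -> : ln M%:R = ln q + 2 * ln d%:R + ln e%:R.
    have {1}-> : M%:R = q * d%:R ^+ 2 * e%:R :> R by rewrite /q; field; lra.
    have qd0 : 0 < q * d%:R ^+ 2 by apply: mulr_gt0.
    rewrite lnM ?posrE // lnM ?posrE // lnXn ?ltr0n //.
    by rewrite [_ *+ 2](esym (mulr_natl _ 2)).
  by rewrite !lerD2r ltW // ln_sublinear.
rewrite !big_split /=.
have h3 := split_prime_part M d0.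
have h1 : \sum_(e < M.+1 | split_sqfree e) M%:R / d%:R ^+ 2 * e%:R^-1 =
   M%:R / d%:R ^+ 2 * split_harmonic M by rewrite -big_distrr.
have h2 : \sum_(e < M.+1 | split_sqfree e) (d ^ 2 * e <= M)%N%:R * (2 * ln d%:R)
   <= 2 * M%:R * (ln d%:R / d%:R ^+ 2).
  rewrite -big_distrl -natr_sum /=.
  have cnt : (\sum_(e < M.+1 | split_sqfree e) (d ^ 2 * e <= M) <= M %/ d ^ 2)%N.
    rewrite -(big_mkord (fun e => split_sqfree e) (fun e => nat_of_bool (d ^ 2 * e <= M)%N)).
    rewrite -big_mkcondr /= -big_filter sum1_size -[leqRHS](size_iota 1).
    apply: uniq_leq_size; first by rewrite filter_uniq ?iota_uniq.
    move=> e; rewrite mem_filter mem_iota => /andP[/andP[/andP[-> _] le] _] /=.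
    by rewrite add1n ltnS leq_divRL // mulnC.
  have cntR : (\sum_(e < M.+1 | split_sqfree e) (d ^ 2 * e <= M))%N%:R
    <= M%:R / d%:R ^+ 2 :> R.
    rewrite ler_pdivlMr // -natrX -natrM ler_nat.
    by rewrite (leq_trans _ (leq_trunc_div M (d ^ 2))) // leq_mul2r cnt orbT.
  apply: le_trans (ler_wpM2r _ cntR) _; first by rewrite mulr_ge0.
  by rewrite le_eqVlt; apply/orP; left; apply/eqP; field; lra.
rewrite h1; move: h2 h3; set s2 := \sum_(e < _ | _) _; set s3 := \sum_(e < _ | _) _.
lra.
Qed.

End LogSums.

(** * Summatory bounds *)

(** Counts the terms of degree n in [theta_coef], with the cone r >= 2y enlarged to the
    quadrant. *)
Definition theta_count (n : nat) : nat :=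
  (\sum_(y < n.+1) \sum_(r < n.+1)
     (((y ^ 2 + r ^ 2).*2 == n) + ((y ^ 2 + r.+1 ^ 2).*2 == n)))%N.

(** 2 (a^2 + b^2) = (a + b)^2 + (a - b)^2. *)
Lemma theta_count_gt0 n : (0 < theta_count n)%N ->
  exists x y, n = (x ^ 2 + y ^ 2)%N.
Proof.
have sq2 a b : exists x y, ((a ^ 2 + b ^ 2).*2 = x ^ 2 + y ^ 2)%N.
  wlog ab : a b / (a <= b)%N.
    by move=> H; case: (leqP a b) => [|/ltnW] ab; [|rewrite addnC]; apply: H.
  exists (b + a)%N, (b - a)%N; rewrite -{1 2}(subnK ab).
  by move: (b - a)%N => c; rewrite -muln2; ring.
rewrite lt0n sum_nat_eq0 negb_forall => /existsP[y].
rewrite sum_nat_eq0 negb_forall => /existsP[r] /=.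
move: (nat_of_ord y) (nat_of_ord r) => a b.
case: (_ =P n) => [<- _|_] /=; first exact: sq2.
by case: (_ =P n) => [<- _|//]; exact: sq2.
Qed.

Lemma sqrt_floor_exists M : exists s, (s ^ 2 <= M < s.+1 ^ 2)%N.
Proof.
elim: M => [|M [s /andP[s1 s2]]]; first by exists 0%N.
case: (leqP (s.+1 ^ 2) M.+1) => h; [exists s.+1 | exists s]; rewrite ?h ?(leqW s1) //=.
by rewrite (leq_trans (_ : M.+2 <= (s.+1 ^ 2).+1)%N) // ltn_sqr.
Qed.

Lemma sum_eq_le (M k : nat) (P : pred nat) :
  (\sum_(1 <= n < M.+1 | P n) (k == n) <= (k <= M))%N.
Proof.
case: (leqP k M) => kM; last first.
  by rewrite big_nat_cond big1 // => n /andP[/andP[_ nM] _]; case: eqP => // kn; lia.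
apply: (@leq_trans (count_mem k (index_iota 1 M.+1))).
  rewrite -sum1_count big_mkcond [leqRHS]big_mkcond /=; apply: leq_sum => n _.
  by rewrite eq_sym; case: ifP => // _; case: eqP.
by rewrite count_uniq_mem ?iota_uniq // leq_b1.
Qed.

Lemma leq_sum_widen (F : nat -> nat) m n : (m <= n)%N ->
  (\sum_(i < m) F i <= \sum_(i < n) F i)%N.
Proof.
move=> mn; rewrite -!(big_mkord xpredT F) [leqRHS](big_cat_nat (n := m)) //=.
exact: leq_addr.
Qed.

(** A lattice point that is counted has both coordinates at most sqrt M, so there are at
    most 2 (sqrt M + 1)^2 of them. *)
Lemma theta_count_mean M : (\sum_(1 <= n < M.+1) theta_count n <= 4 * M + 4)%N.
Proof.
have [s /andP[s1 s2]] := sqrt_floor_exists M.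
pose K := (\sum_(y < M.+1) (y ^ 2 <= M))%N.
have Ks : (K <= s.+1)%N.
  apply: (@leq_trans (\sum_(0 <= y < M.+1) (y < s.+1))%N).
    rewrite big_mkord; apply: leq_sum => y _; case yM: (y ^ 2 <= M)%N => //.
    by rewrite lt0b -ltn_sqr (leq_ltn_trans yM).
  rewrite -big_mkcond /= -big_filter sum1_size -[leqRHS](size_iota 0).
  apply: uniq_leq_size; first by rewrite filter_uniq ?iota_uniq.
  by move=> y; rewrite mem_filter mem_iota => /andP[].
have termK y r : (((y ^ 2 + r ^ 2).*2 <= M) + ((y ^ 2 + r.+1 ^ 2).*2 <= M)
    <= 2 * ((y ^ 2 <= M) * (r ^ 2 <= M)))%N.
  have h1 : ((y ^ 2 + r ^ 2).*2 <= M -> (y ^ 2 <= M) && (r ^ 2 <= M))%N.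
    by rewrite -addnn => h; apply/andP; split; apply: leq_trans h; lia.
  have h2 : ((y ^ 2 + r.+1 ^ 2).*2 <= M -> (y ^ 2 + r ^ 2).*2 <= M)%N.
    by apply: leq_trans; rewrite leq_double leq_add2l leq_sqr.
  move: h1 h2; case: ((y ^ 2 + r ^ 2).*2 <= M)%N; case: ((y ^ 2 + r.+1 ^ 2).*2 <= M)%N => //=.
  - by move=> /(_ isT)/andP[-> ->].
  - by move=> /(_ isT)/andP[-> ->].
  - by move=> _ /(_ isT).
apply: (@leq_trans (2 * (K * K))); last first.
  by apply: (@leq_trans (2 * (s.+1 * s.+1))); [rewrite leq_pmul2l // leq_mul | nia].
apply: (@leq_trans (\sum_(y < M.+1) \sum_(r < M.+1)
   ((((y ^ 2 + r ^ 2).*2 <= M) + ((y ^ 2 + r.+1 ^ 2).*2 <= M)))%N)); last first.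
  rewrite /K big_distrl big_distrr /=; apply: leq_sum => y _.
  by rewrite !big_distrr /=; apply: leq_sum => r _; exact: termK.
apply: (@leq_trans (\sum_(1 <= n < M.+1) \sum_(y < M.+1) \sum_(r < M.+1)
   ((((y ^ 2 + r ^ 2).*2 == n) + ((y ^ 2 + r.+1 ^ 2).*2 == n)))%N)).
  rewrite big_nat_cond [leqRHS]big_nat_cond; apply: leq_sum => n /andP[/andP[_ nM] _].
  pose F y r := (((y ^ 2 + r ^ 2).*2 == n) + ((y ^ 2 + r.+1 ^ 2).*2 == n))%N.
  apply: leq_trans (leq_sum_widen (fun y => \sum_(r < n.+1) F y r)%N nM) _.
  by apply: leq_sum => y _ /=; exact: (leq_sum_widen (F y) nM).
rewrite exchange_big /=; apply: leq_sum => y _.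
rewrite exchange_big /=; apply: leq_sum => r _.
by rewrite big_split /= leq_add // (sum_eq_le _ _ xpredT).
Qed.

Lemma two_sqr_count (P : pred nat) M :
  (forall n, (0 < n)%N -> P n -> exists x y, n = x ^ 2 + y ^ 2)%N ->
  (\sum_(1 <= n < M.+1 | P n) 1 <=
   2 * \sum_(1 <= d < M.+1) \sum_(e < M.+1 | split_sqfree e) (d ^ 2 * e <= M))%N.
Proof.
move=> Psq; rewrite big_distrr /=.
apply: (@leq_trans (\sum_(1 <= n < M.+1 | P n)
   \sum_(1 <= d < M.+1) \sum_(e < M.+1 | split_sqfree e)
   ((d ^ 2 * e == n) + (2 * (d ^ 2 * e) == n)))%N).
  rewrite big_nat_cond [leqRHS]big_nat_cond; apply: leq_sum => n /andP[/andP[n0 nM] Pn].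
  have [x [y nE]] := Psq n n0 Pn.
  have [||d [e [d0 [se hn]]]] := @even_logn_decomp n; first exact: n0.
    by move=> p pp p3; rewrite nE; apply: sum_sqr_logn => //; rewrite -nE.
  have /andP[e0 _] := se.
  have dn : (d <= n)%N by case: hn => ->; nia.
  have en : (e < M.+1)%N by rewrite (leq_ltn_trans _ nM) //; case: hn => ->; nia.
  rewrite (bigD1_seq d) ?iota_uniq //=; last by rewrite mem_index_iota d0 (leq_ltn_trans dn).
  rewrite (bigD1 (Ordinal en)) //=; case: hn => <-; rewrite eqxx; lia.
rewrite exchange_big /=; apply: leq_sum => d _; rewrite big_distrr exchange_big /=.
apply: leq_sum => e _; rewrite big_split /= [leqRHS]mul2n -addnn leq_add //.
  exact: sum_eq_le.
apply: leq_trans (sum_eq_le M (2 * (d ^ 2 * e))%N P) _.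
case: (leqP (2 * (d ^ 2 * e)) M) => // h.
by rewrite (leq_trans _ h) // leq_pmull.
Qed.

Section Analysis.
Variable R : realType.

(** Summation by parts, arranged as an induction: E(m), the slack of the hypothesis at
    m, is nonnegative, and the term E(m) z^(m+1) absorbs what the partial sums of c leave
    below the linear bound. *)
Lemma power_sum_le (c : nat -> R) (a b z : R) (M : nat) :
  0 < z < 1 -> 0 <= a -> 0 <= b ->
  (forall m, \sum_(1 <= n < m.+1) c n <= a * m%:R + b) ->
  \sum_(1 <= n < M.+1) c n * z ^+ n <= a / (1 - z) + b.
Proof.
move=> /andP[z0 z1] a0 b0 cS.
pose E m := a * m%:R + b - \sum_(1 <= n < m.+1) c n.
have E0 m : 0 <= E m by rewrite subr_ge0.
have H m : \sum_(1 <= n < m.+1) c n * z ^+ n + E m * z ^+ m.+1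
    <= a * (\sum_(1 <= n < m.+1) z ^+ n) + b.
  elim: m => [|m IH].
    by rewrite /E !big_geq // !mulr0 !add0r subr0 expr1 ler_piMr // ltW.
  rewrite big_nat_recr //= [in leRHS]big_nat_recr //=.
  have EE : E m.+1 = E m + a - c m.+1 by rewrite /E big_nat_recr //= -natr1; ring.
  have : E m.+1 * z ^+ m.+2 <= E m.+1 * z ^+ m.+1.
    by apply: ler_wpM2l => //; rewrite [z ^+ m.+2]exprS ler_piMl ?exprn_ge0 // ltW.
  rewrite EE mulrDr; move: IH.
  move: (\sum_(1 <= n < m.+1) c n * z ^+ n) (\sum_(1 <= n < m.+1) z ^+ n) => S1 S2.
  move: (E m) (c m.+1) (z ^+ m.+1) (z ^+ m.+2) => e d Z Z' h1 h2.
  have h3 : d * Z + (e + a - d) * Z = e * Z + a * Z by ring.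
  lra.
apply: le_trans (le_trans _ (H M)) _.
  by rewrite lerDl mulr_ge0 // exprn_ge0 // ltW.
rewrite lerD2r ler_wpM2l // -[leRHS]mul1r ler_pdivlMr ?subr_gt0 //.
have -> : (\sum_(1 <= n < M.+1) z ^+ n) * (1 - z) = z - z ^+ M.+1.
  elim: M => [|M IH]; first by rewrite big_geq // mul0r expr1 subrr.
  by rewrite big_nat_recr //= mulrDl IH [z ^+ M.+2]exprS; ring.
by rewrite lerBlDr (le_trans (ltW z1)) // lerDl exprn_ge0 // ltW.
Qed.

Lemma cvg_bound (u : nat -> R) (B : R) : cvgn u -> (forall n, `|u n| <= B) -> `|limn u| <= B.
Proof.
move=> cu uB; rewrite -lim_norm //; apply: limr_le; first exact: is_cvg_norm.
by near=> n; exact: uB.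
Unshelve. all: by end_near. Qed.

Lemma cvg_nneg_bounded (u : nat -> R) (B : R) :
  (forall n, 0 <= u n) -> (forall n, \sum_(1 <= k < n) u k <= B) ->
  cvgn (fun n => \sum_(1 <= k < n) u k).
Proof.
move=> u0 uB; apply: nondecreasing_is_cvgn.
  apply/nondecreasing_seqP => n; case: n => [|n]; first by rewrite !big_geq.
  by rewrite [leRHS]big_nat_recr //= lerDl.
by exists B => _ [n _ <-].
Qed.

Lemma cvg_bounded_abs (u : nat -> R) (B : R) :
  (forall n, \sum_(1 <= k < n) `|u k| <= B) ->
  cvgn (fun n => \sum_(1 <= k < n) u k).
Proof.
move=> uB; pose v k := if k == 0%N then 0 else u k.
have vE (w : nat -> R) n : w 0%N = 0 -> \sum_(1 <= k < n) w k = \sum_(0 <= k < n) w k.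
  by move=> w0; case: n => [|n]; [rewrite !big_geq | rewrite [RHS]big_ltn // w0 add0r].
have -> : (fun n => \sum_(1 <= k < n) u k) = series v.
  apply/funext => n; rewrite /series /= -vE //.
  by apply: eq_big_nat => k /andP[k0 _]; rewrite /v gtn_eqF.
apply: normed_cvg.
have -> : [normed series v] = (fun n => \sum_(1 <= k < n) `|u k|).
  apply/funext => n; rewrite /normed_series_of seriesEnat /=.
  have /= <- := vE (fun k => `|v k|) n (normr0 _).
  by apply: eq_big_nat => k /andP[k0 _]; rewrite /v gtn_eqF.
exact: cvg_nneg_bounded uB.
Qed.

Lemma split_harmonic_ln M : (0 < M)%N -> split_harmonic R M ^+ 2 <= 1 + 2 * ln M%:R.
Proof.
move=> M0; apply: le_trans (split_harmonic_sqr R M0) _.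
apply: le_trans (harmonic_sum_ln R _) _; first by rewrite expn_gt0 M0.
by rewrite natrX lnXn ?ltr0n // [_ *+ 2](esym (mulr_natl _ 2)).
Qed.

(** The bound of [sqfree_pairs_le], divided by M, is of order sqrt (1 + 2 log M) / log M,
    which decreases with log M; and log M is at least L/2 here. *)
Lemma sqfree_pairs_bound (M : nat) (L : R) : 2 <= L -> L <= 2 * ln M%:R ->
  sqfree_pairs R M <= 30 * M%:R / Num.sqrt L.
Proof.
move=> L2 LM; have L0 : 0 < L by lra.
have M0 : (0 < M)%N by case: M LM => // h; rewrite ln0 // in h; lra.
have MR : 0 < M%:R :> R by rewrite ltr0n.
set t := ln M%:R in LM *; have t0 : 0 < t by lra.
have sL : 0 < Num.sqrt L by rewrite sqrtr_gt0.
have D0 : 0 <= sqfree_pairs R M by rewrite sumr_ge0 // => d _; rewrite sumr_ge0.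
rewrite ler_pdivlMr // -(ler_pM2r t0).
rewrite mulrAC; apply: le_trans (ler_wpM2r (ltW sL) (sqfree_pairs_le R M0)) _.
have H0 : 0 <= split_harmonic R M by rewrite sumr_ge0 // => e _; rewrite invr_ge0 ler0n.
(* squared: (1 + 2 t) L <= (1 + 2 t) 2 t <= 6 t^2 <= (5 t / 2)^2, as t >= 1 *)
have HL : split_harmonic R M * Num.sqrt L <= 5 / 2 * t.
  rewrite -(@ler_pXn2r _ 2) ?nnegrE ?mulr_ge0 // ?(ltW sL) //; last lra.
  rewrite !exprMn sqr_sqrtr ?(ltW L0) //.
  have h := split_harmonic_ln M0; rewrite -/t in h.
  have h1 : split_harmonic R M ^+ 2 * L <= (1 + 2 * t) * L by rewrite ler_pM2r.
  have h2 : (1 + 2 * t) * L <= (1 + 2 * t) * (2 * t) by rewrite ler_pM2l //; lra.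
  have t1 : 1 * t <= t * t by rewrite ler_pM2r //; lra.
  rewrite expr2; lra.
have h4 := ler_wpM2l (ltW MR) HL.
move: h4; lra.
Qed.

(** The bound is stated for all M with a fixed parameter N, linear in M, as required by
    [power_sum_le]: the numbers up to sqrt N are counted trivially, and above sqrt N the
    logarithm of M is at least half that of N. *)
Lemma two_sqr_count_bound (P : pred nat) (M : nat) (N : R) :
  (forall n, (0 < n)%N -> P n -> exists x y, n = x ^ 2 + y ^ 2)%N ->
  0 < N -> 2 <= ln N ->
  \sum_(1 <= n < M.+1) (P n)%:R <= 60 / Num.sqrt (ln N) * M%:R + Num.sqrt N.
Proof.
move=> Psq N0 L2; have sL : 0 < Num.sqrt (ln N) by rewrite sqrtr_gt0; lra.
case: (leP M%:R (Num.sqrt N)) => MN.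
  apply: (@le_trans _ _ M%:R).
    apply: (@le_trans _ _ (\sum_(1 <= n < M.+1) 1)).
      by apply: ler_sum => n _; case: (P n).
    by rewrite big_const_nat subn1 /= iter_addr_0.
  by apply: le_trans MN _; rewrite lerDr mulr_ge0 // divr_ge0 // ltW.
have sN : 0 < Num.sqrt N by rewrite sqrtr_gt0.
have MR : 0 < M%:R :> R by exact: lt_trans sN MN.
have LM : ln N <= 2 * ln M%:R.
  rewrite (mulr_natl (ln M%:R) 2) -lnXn // ler_ln ?posrE ?exprn_gt0 //.
  by rewrite -[leLHS](sqr_sqrtr (ltW N0)) ler_pXn2r ?nnegrE ?(ltW MN) // ltW.
have h := sqfree_pairs_bound L2 LM.
have h2 : \sum_(1 <= n < M.+1) (P n)%:R <= 2 * sqfree_pairs R M.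
  have := two_sqr_count M Psq; rewrite -(ler_nat R) natrM !natr_sum.
  have -> : \sum_(1 <= n < M.+1 | P n) 1 = \sum_(1 <= n < M.+1) (P n)%:R :> R.
    by rewrite big_mkcond; apply: eq_bigr => n _; case: (P n).
  by under [in X in _ <= 2 * X -> _]eq_bigr do rewrite natr_sum.
have h3 : 60 / Num.sqrt (ln N) * M%:R = 2 * (30 * M%:R / Num.sqrt (ln N)) by field; lra.
by rewrite h3; lra.
Qed.

End Analysis.

(** * The asymptotic estimates *)

Lemma p3_le_theta_count n : (0 < n)%N -> `|p3 n| <= (theta_count n)%:R.
Proof.
move=> n0; apply: le_trans (theta_bound n0) _.
rewrite /theta_count natr_sum; apply: ler_sum => y _.
by rewrite natr_sum.
Qed.

Lemma p3_pos_two_sqr n : (0 < n)%N -> 0 < p3 n -> exists x y, n = (x ^ 2 + y ^ 2)%N.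
Proof.
move=> n0 pn; apply: theta_count_gt0.
have h0 : 0 < `|p3 n| by rewrite normr_gt0 gt_eqF.
by have := lt_le_trans h0 (@p3_le_theta_count n n0); rewrite ltr0n.
Qed.

Section Final.
Variable R : realType.

Lemma p3_abs_sum_le (z : R) (N : nat) : 0 < z < 1 ->
  \sum_(1 <= n < N) `|(p3 n)%:~R * z ^+ n| <= 8 / (1 - z).
Proof.
move=> z01; have /andP[z0 z1] := z01; case: N => [|M].
  by rewrite big_geq // divr_ge0 //; lra.
apply: (@le_trans _ _ (\sum_(1 <= n < M.+1) (theta_count n)%:R * z ^+ n)).
  apply: ler_sum_nat => n /andP[n0 _].
  rewrite normrM [`|z ^+ n|]ger0_norm ?exprn_ge0 ?(ltW z0) //.
  rewrite ler_pM2r ?exprn_gt0 // -intr_norm.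
  have := p3_le_theta_count n0; rewrite -(ler_int R).
  by rewrite rmorph_nat.
apply: le_trans (@power_sum_le R _ 4 4 z M z01 _ _ _) _ => //.
  by move=> m; rewrite -natr_sum -natrM -natrD ler_nat theta_count_mean.
have h : 1 <= 1 / (1 - z) by rewrite ler_pdivlMr; lra.
lra.
Qed.

Lemma p3_pos_sumE (z : R) (N : nat) :
  p3_pos_partial_sum z N = \sum_(1 <= n < N) (0 < p3 n)%R%:R * z ^+ n.
Proof.
rewrite /p3_pos_partial_sum big_mkcond; apply: eq_bigr => n _.
by case: ifP; rewrite ?mul1r ?mul0r.
Qed.

(** [power_sum_le] applied to [two_sqr_count_bound] with N = 1/(1 - z); the term
    sqrt N is absorbed because log N <= N. *)
Lemma p3_pos_sum_le (z : R) (N : nat) : 0 < z < 1 -> 2 <= ln (1 / (1 - z)) ->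
  p3_pos_partial_sum z N <= 61 * (1 / ((1 - z) * Num.sqrt (ln (1 / (1 - z))))).
Proof.
move=> z01; have /andP[z0 z1] := z01; set T := 1 / (1 - z) => L2.
have T0 : 0 < T by rewrite divr_gt0 //; lra.
have sL : 0 < Num.sqrt (ln T) by rewrite sqrtr_gt0; lra.
have sT : 0 < Num.sqrt T by rewrite sqrtr_gt0.
have rhs : 1 / ((1 - z) * Num.sqrt (ln T)) = T / Num.sqrt (ln T).
  rewrite /T; field; apply/andP; split; [lra|lra].
rewrite rhs p3_pos_sumE; case: N => [|M].
  by rewrite big_geq // mulr_ge0 // divr_ge0 // ltW.
apply: le_trans (@power_sum_le R _ (60 / Num.sqrt (ln T)) (Num.sqrt T) z M z01 _ _ _) _.
- by rewrite divr_ge0 // ltW.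
- exact: ltW.
- move=> m; apply: two_sqr_count_bound => //.
  by move=> n n0 pn; apply: p3_pos_two_sqr.
have -> : 60 / Num.sqrt (ln T) / (1 - z) = 60 * (T / Num.sqrt (ln T)).
  by rewrite /T; field; apply/andP; split; lra.
have : Num.sqrt T <= T / Num.sqrt (ln T).
  rewrite ler_pdivlMr // -[leRHS](sqr_sqrtr (ltW T0)) expr2 ler_pM2l //.
  by rewrite ler_sqrt // ltW // ln_sublinear.
lra.
Qed.

End Final.

Theorem theorem1p4 (R : realType) :
  ((forall z : R, 0 < z < 1 -> cvgn (p3_partial_sum z)) /\
   bigO_at_left1 (fun z : R => limn (p3_partial_sum z))
     (fun z : R => 1 / (1 - z))) /\
  ((forall z : R, 0 < z < 1 -> cvgn (p3_pos_partial_sum z)) /\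
   bigO_at_left1 (fun z : R => limn (p3_pos_partial_sum z))
     (fun z : R => 1 / ((1 - z) * Num.sqrt (ln (1 / (1 - z)))))).
Proof.
have cv1 (z : R) : 0 < z < 1 -> cvgn (p3_partial_sum z).
  by move=> z01; apply: cvg_bounded_abs => n; exact: p3_abs_sum_le.
have pos0 (z : R) n : 0 < z < 1 -> 0 <= (0 < p3 n)%R%:R * z ^+ n.
  by move=> /andP[z0 _]; rewrite mulr_ge0 // exprn_ge0 // ltW.
have cv2 (z : R) : 0 < z < 1 -> cvgn (p3_pos_partial_sum z).
  move=> z01; rewrite (_ : p3_pos_partial_sum z =
    (fun N => \sum_(1 <= n < N) (0 < p3 n)%R%:R * z ^+ n)); last first.
    by apply/funext => N; exact: p3_pos_sumE.
  apply: (@cvg_nneg_bounded R _ (8 / (1 - z))) => [n|N]; first exact: pos0.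
  apply: (le_trans _ (p3_abs_sum_le N z01)); apply: ler_sum => n _.
  have /andP[z0 _] := z01.
  rewrite normrM [`|z ^+ n|]ger0_norm ?exprn_ge0 ?(ltW z0) //.
  rewrite ler_wpM2r ?exprn_ge0 ?(ltW z0) //; case: (ltP 0 (p3 n)) => p0; last exact: normr_ge0.
  by rewrite -intr_norm ler1z -gtz0_ge1 normr_gt0 gt_eqF.
split; split => //.
- exists 8 => //; near=> z.
  have z01 : 0 < z < 1.
    by apply/andP; split; near: z; [exact: nbhs_left_gt|exact: nbhs_left_lt].
  rewrite mulrA mulr1; apply: cvg_bound; first exact: cv1.
  move=> N; apply: (le_trans _ (p3_abs_sum_le N z01)); exact: ler_norm_sum.
- exists 61 => //; near=> z.
  have z01 : 0 < z < 1.
    by apply/andP; split; near: z; [exact: nbhs_left_gt|exact: nbhs_left_lt].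
  have zL : 2 <= ln (1 / (1 - z)).
    have z2 : 1 - expR (-2) < z.
      near: z; apply: nbhs_left_gt; have := expR_gt0 (-2 : R); lra.
    have /andP[z0 z1] := z01.
    rewrite div1r lnV ?posrE; last lra.
    rewrite lerNr -[leRHS]expRK ler_ln ?posrE ?expR_gt0 //; lra.
  apply: cvg_bound; first exact: cv2.
  move=> N; rewrite ger0_norm; first exact: p3_pos_sum_le.
  by rewrite p3_pos_sumE sumr_ge0 // => n _; exact: pos0.
Unshelve. all: by end_near.
Qed.
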